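(* Let $k\geqslant 1$ be an integer and let $\rho\in L^1(0,1)$ be a non-negative function which is not zero almost everywhere. Let $\Lambda(k,\rho)$ be defined by $$\frac{1}{\Lambda(k,\rho)}=\inf_{\substack{u\in H^k_0(0,1)\\ u\neq 0}}\frac{\left(\int_0^1|u^{(k)}(x)|^2\,dx\right)^{1/2}}{\int_0^1|u(x)|\rho(x)\,dx},$$ and put $\mu=\left(\frac{1}{\Lambda(k,\rho)}\right)^2$. Let $A=(A_{mj})_{0\leqslant m,j\leqslant k-1}$ be the $k\times k$ matrix with entries $$A_{mj}=\frac{(k+m)!}{(k+m-j)!},$$ and let $$b_m=(-1)^{k+1}\int_0^1(1-t)^{k+m}\rho(t)\,dt,\qquad m=0,1,\dots,k-1.$$ Then $A$ is invertible and $$\frac{1}{\mu}=\int_0^1\left[\sum_{j=0}^{k-1}\frac{x^{k-1-j}}{(k-1-j)!}\sum_{m=0}^{k-1}\left(A^{-1}\right)_{jm}b_m+(-1)^k\int_0^x\frac{(x-t)^{k-1}}{(k-1)!}\,\rho(t)\,dt\right]^2dx.$$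
   Context: Functions are real-valued. $H^k_0(0,1)$ denotes the space of all $u\in H^k(0,1)$ (the $L^2$-based Sobolev space of order $k$) with $u^{(j)}(0)=u^{(j)}(1)=0$ for $0\leqslant j\leqslant k-1$. In the infimum, quotients with zero denominator are interpreted as $+\infty$. *)

(* Defs.v *)
From HB Require Import structures.
From mathcomp Require Import all_boot all_order all_algebra.
From mathcomp Require Import all_classical all_reals all_analysis.

Set Implicit Arguments.
Unset Strict Implicit.
Unset Printing Implicit Defensive.

Import Order.TTheory GRing.Theory Num.Theory numFieldNormedType.Exports.
Local Open Scope classical_set_scope.
Local Open Scope ring_scope.

(* Functions on (0,1) are represented by functions R -> R whose values outside
   ]0, 1[ are irrelevant (up to null sets, their values inside as well). *)
Definition I01 (R : realType) : set R := `]0, 1[%classic.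
Arguments I01 : clear implicits.

Definition ae_zero (R : realType) (f : R -> R) : Prop :=
  {ae @lebesgue_measure R, forall x, I01 R x -> f x = 0}.

Definition L1 (R : realType) (f : R -> R) : Prop :=
  (@lebesgue_measure R).-integrable (I01 R) (EFin \o f).

Definition L2 (R : realType) (f : R -> R) : Prop :=
  measurable_fun (I01 R) f /\
  (@lebesgue_measure R).-integrable (I01 R) (fun x => (f x ^+ 2)%:E).

(* C_c^oo(0,1) *)
Definition test_function (R : realType) (phi : R -> R) : Prop :=
  [/\ forall (n : nat) (x : R), derivable (derive1n n phi) x 1,
      compact (closure [set x | phi x != 0]) &
      closure [set x | phi x != 0] `<=` I01 R].

(* v is a weak derivative of order j of u on (0,1); for j = 0 this says that
   u and v agree almost everywhere. Only used with u in L^2, and v in L^2 or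
   continuous on [0,1], so that both integrals exist. *)
Definition weak_deriv (R : realType) (j : nat) (u v : R -> R) : Prop :=
  forall phi : R -> R, test_function phi ->
    \int[@lebesgue_measure R]_(x in I01 R) (u x * derive1n j phi x) =
    (-1) ^+ j * \int[@lebesgue_measure R]_(x in I01 R) (v x * phi x).

Definition sobolev (R : realType) (k : nat) (u : R -> R) : Prop :=
  L2 u /\
  forall j : nat, (j <= k)%N -> exists2 v, L2 v & weak_deriv j u v.

(* u^(j)(0) = u^(j)(1) = 0, where u^(j) is evaluated through its continuous
   representative on [0,1] (it exists for j < k when u is in H^k(0,1)). *)
Definition vanishing_boundary (R : realType) (j : nat) (u : R -> R) : Prop :=
  exists v : R -> R,
    [/\ {within `[0, 1]%classic, continuous v}, weak_deriv j u v,
        v 0 = 0 & v 1 = 0].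

Definition sobolev0 (R : realType) (k : nat) (u : R -> R) : Prop :=
  sobolev k u /\ forall j : nat, (j < k)%N -> vanishing_boundary j u.

(* The quotient associated with u, where uk is the k-th weak derivative of u. *)
Definition quotient (R : realType) (rho u uk : R -> R) : \bar R :=
  let num := Num.sqrt
    (\int[@lebesgue_measure R]_(x in I01 R) (`|uk x| ^+ 2)) in
  let den := \int[@lebesgue_measure R]_(x in I01 R) (`|u x| * rho x) in
  if den == 0 then +oo%E else (num / den)%:E.

Definition quotients (R : realType) (k : nat) (rho : R -> R) : set (\bar R) :=
  [set q | exists u uk : R -> R,
     [/\ sobolev0 k u, ~ ae_zero u, L2 uk, weak_deriv k u uk &
         q = quotient rho u uk]].

(* Lambda is defined by 1 / Lambda = inf; the inverse on \bar R is involutive,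
   with 0^-1 = +oo and +oo^-1 = 0. *)
Definition Lambda (R : realType) (k : nat) (rho : R -> R) : \bar R :=
  ((ereal_inf (quotients k rho))^-1)%E.

Definition mu (R : realType) (k : nat) (rho : R -> R) : \bar R :=
  ((Lambda k rho)^-1 ^+ 2)%E.

Definition Amx (R : realType) (k : nat) : 'M[R]_k :=
  \matrix_(m < k, j < k) (((k + m)`!)%:R / ((k + m - j)`!)%:R).

Definition bvec (R : realType) (k : nat) (rho : R -> R) (m : nat) : R :=
  (-1) ^+ k.+1 *
  \int[@lebesgue_measure R]_(t in I01 R) ((1 - t) ^+ (k + m) * rho t).

(* Main.v *)
Require Import Defs.
From HB Require Import structures.
From mathcomp Require Import all_boot all_order all_algebra.
From mathcomp Require Import all_classical all_reals all_analysis.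
Import Order.TTheory GRing.Theory Num.Theory numFieldNormedType.Exports.
From mathcomp Require Import measurable_realfun ring lra.
Local Open Scope classical_set_scope.
Local Open Scope ring_scope.

(** Write k = n + 1 and let P be the space of polynomials of degree less than k.
    A function u with vanishing boundary values is determined by its k-th
    derivative w: the conditions at 0 say that u is the k-fold primitive of w,
    and the conditions at 1 say that w is orthogonal to P (sobolev0_repr,
    sobolev0_J). So the problem takes place in the orthogonal complement of P in
    L2, and integration of u against an integrable f becomes a linear form in w,
    represented by a bounded function riesz n f (riesz_pairing).

    If the denominator of the quotient were the integral of u rho, without the
    absolute value, Cauchy-Schwarz would finish the proof: the supremum of that
    integral over unit w is the norm of riesz n rho. To deal with |u|,
    write |u| rho = u f with f the product of rho and the sign of u. The bound is
    then the norm of riesz n f, whose square is the double integral of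
    f(y) f(z) G(y, z), where G is the Green function of the operator
    (- 1) ^ k d ^ 2k / dx ^ 2k with Dirichlet conditions. Since G is positive
    and |f| <= rho, this is at most the same integral for rho (riesz_le). Hence
    mu ^ -1 is the squared norm of riesz n rho, attained by the solution u of
    (- 1) ^ k u ^ (2 k) = rho (quotients_inf).

    Positivity of G is Boggio's formula, which in dimension one is an explicit
    sum of nonnegative terms (green_left_gt0). That the formula gives the Green
    function rests on the identity green_jump between its two branches, itself a
    consequence of the symmetry of T ^ n (T - d) ^ n. Derivatives of this
    identity at the point 1 form a linear system with matrix A for the
    coefficients of G, whose right-hand sides span, so that A is invertible
    (Amx_unit); and integrating the solution against rho produces the closed
    formula of the statement (rieszE). *)

Set Implicit Arguments.
Unset Strict Implicit.
Unset Printing Implicit Defensive.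

(** * Integrals and bounded kernels on the unit interval *)

Section UnitInterval.
Context {R : realType}.
Local Notation leb := (@lebesgue_measure R).
Implicit Types (f g w : R -> R) (K : R -> R -> R).

Lemma I01E (x : R) : I01 R x = (0 < x < 1) :> Prop.
Proof. by rewrite /I01 /= in_itv. Qed.

Lemma measurable_I01 : measurable (I01 R).
Proof. exact: measurable_itv. Qed.
Hint Resolve measurable_I01 : core.

Lemma leb_I01 : leb (I01 R) = 1%:E.
Proof. by rewrite /I01 lebesgue_measure_itv/= lte_fin ltr01 oppr0 adde0. Qed.

(** Measurable and bounded on the interval: the class of multipliers that keeps
    every integrand below integrable. *)
Definition bdd f := measurable_fun (I01 R) f /\
  exists C, forall x, I01 R x -> `|f x| <= C.

Lemma L1_meas f : L1 f -> measurable_fun (I01 R) f.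
Proof. by move=> /integrableP[/measurable_EFinP]. Qed.

Lemma bdd_bounded f : bdd f -> [bounded f x | x in I01 R].
Proof.
move=> [_ [C hC]]; exists C; split; first exact: num_real.
by move=> M CM x /hC /le_trans; apply; exact: ltW.
Qed.

Lemma bdd_L1 f : bdd f -> L1 f.
Proof.
move=> bf; have fin : (leb (I01 R) < +oo)%E by rewrite leb_I01 ltry.
exact: (@measurable_bounded_integrable _ _ _ leb f _ measurable_I01 fin bf.1
  (bdd_bounded bf)).
Qed.

Lemma bddM f g : bdd f -> bdd g -> bdd (fun x => f x * g x).
Proof.
move=> [mf [C hC]] [mg [C' hC']]; split; first exact: measurable_funM.
exists (C * C') => x xI; rewrite normrM ler_pM//; [exact: hC|exact: hC'].
Qed.

Lemma bddD f g : bdd f -> bdd g -> bdd (fun x => f x + g x).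
Proof.
move=> [mf [C hC]] [mg [C' hC']]; split; first exact: measurable_funD.
exists (C + C') => x xI; rewrite (le_trans (ler_normD _ _))// lerD//.
  exact: hC.
exact: hC'.
Qed.

Lemma bdd_cst c : bdd (fun=> c).
Proof. by split; [exact: measurable_cst|exists `|c|]. Qed.

Lemma bddN f : bdd f -> bdd (fun x => - f x).
Proof.
move=> [mf [C hC]]; split; first exact: measurableT_comp.
by exists C => x xI; rewrite normrN; exact: hC.
Qed.

Lemma L1Z c f : L1 f -> L1 (fun x => c * f x).
Proof. by move=> Lf; exact: (@integrableZl _ _ _ leb _ measurable_I01 c (EFin \o f) Lf). Qed.

Lemma L1D f g : L1 f -> L1 g -> L1 (fun x => f x + g x).
Proof. by move=> Lf Lg; exact: (@integrableD _ _ _ leb _ measurable_I01 (EFin \o f) (EFin \o g) Lf Lg). Qed.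

Lemma L1B f g : L1 f -> L1 g -> L1 (fun x => f x - g x).
Proof. by move=> Lf Lg; exact: (@integrableB _ _ _ leb _ measurable_I01 (EFin \o f) (EFin \o g) Lf Lg). Qed.

Lemma L1_norm f : L1 f -> L1 (fun x => `|f x|).
Proof. exact: integrable_norm. Qed.

Lemma L1_bddM f g : bdd f -> L1 g -> L1 (fun x => f x * g x).
Proof.
move=> bf Lg; exact: (@integrableMr _ _ _ leb _ measurable_I01 f (EFin \o g) bf.1
  (bdd_bounded bf) Lg).
Qed.

Lemma L1_le f g : measurable_fun (I01 R) f ->
  (forall x, I01 R x -> `|f x| <= `|g x|) -> L1 g -> L1 f.
Proof.
move=> mf fg; apply: le_integrable => //; exact/measurable_EFinP.
Qed.

Lemma L2_bdd f : bdd f -> L2 f.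
Proof.
move=> bf; split; first by case: bf.
exact: (bdd_L1 (bddM bf bf)).
Qed.

Lemma L2M_L1 f g : L2 f -> L2 g -> L1 (fun x => f x * g x).
Proof.
move=> [mf if2] [mg ig2].
have : L1 (fun x => f x ^+ 2 + g x ^+ 2) by exact: L1D.
apply: L1_le; first exact: measurable_funM.
move=> x _; rewrite normrM [leRHS]ger0_norm; last by rewrite addr_ge0 ?sqr_ge0.
rewrite -(real_normK (num_real (f x))) -(real_normK (num_real (g x))).
nra.
Qed.

Lemma L2_L1 f : L2 f -> L1 f.
Proof.
move=> Lf; have := L2M_L1 Lf (L2_bdd (bdd_cst 1)).
by congr (L1 _); apply/funext => x; rewrite mulr1.
Qed.

Lemma L1_sqr f : L2 f -> L1 (fun x => f x ^+ 2).
Proof. by case. Qed.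

Lemma int01Z c f : L1 f ->
  \int[leb]_(x in I01 R) (c * f x) = c * \int[leb]_(x in I01 R) f x.
Proof. exact: RintegralZl. Qed.

Lemma int01D f g : L1 f -> L1 g -> \int[leb]_(x in I01 R) (f x + g x) =
  \int[leb]_(x in I01 R) f x + \int[leb]_(x in I01 R) g x.
Proof. exact: RintegralD. Qed.

Lemma int01B f g : L1 f -> L1 g -> \int[leb]_(x in I01 R) (f x - g x) =
  \int[leb]_(x in I01 R) f x - \int[leb]_(x in I01 R) g x.
Proof. exact: RintegralB. Qed.

Lemma int01_EFin f : L1 f ->
  (\int[leb]_(x in I01 R) (f x)%:E)%E = (\int[leb]_(x in I01 R) f x)%:E.
Proof.
by move=> Lf; rewrite /Rintegral fineK//; exact: integrable_fin_num Lf.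
Qed.

Lemma int01_cst c : \int[leb]_(x in I01 R) c = c.
Proof.
transitivity (c * fine (leb (I01 R))); last by rewrite leb_I01 mulr1.
exact: Rintegral_cst.
Qed.

Lemma int01_sum (I : Type) (s : seq I) (F : I -> R -> R) :
  (forall i, L1 (F i)) ->
  L1 (fun x => \sum_(i <- s) F i x) /\
  \int[leb]_(x in I01 R) (\sum_(i <- s) F i x) =
  \sum_(i <- s) \int[leb]_(x in I01 R) F i x.
Proof.
move=> LF; elim: s => [|i s [IH1 IH2]].
  split; last first.
    rewrite big_nil; under eq_Rintegral do rewrite big_nil.
    exact: int01_cst.
  by under eq_fun do rewrite big_nil; exact/bdd_L1/bdd_cst.
split; first by under eq_fun do rewrite big_cons; exact: L1D.
by under eq_Rintegral do rewrite big_cons; rewrite int01D// IH2 big_cons.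
Qed.

Lemma eq_int01 f g : (forall x, 0 < x < 1 -> f x = g x) ->
  \int[leb]_(x in I01 R) f x = \int[leb]_(x in I01 R) g x.
Proof. by move=> fg; apply: eq_Rintegral => x; rewrite inE I01E => /fg. Qed.

Lemma ae_imp (P Q : R -> Prop) : (forall x, P x -> Q x) ->
  {ae leb, forall x, P x} -> {ae leb, forall x, Q x}.
Proof. exact: (@filterS _ _ (ae_filter_ringOfSetsType leb) P Q). Qed.

Lemma ae_eq_int01 f g : measurable_fun (I01 R) f -> measurable_fun (I01 R) g ->
  {ae leb, forall x, I01 R x -> f x = g x} ->
  \int[leb]_(x in I01 R) f x = \int[leb]_(x in I01 R) g x.
Proof.
move=> mf mg fg; congr fine; apply: ae_eq_integral => //; [exact/measurable_EFinP..|].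
by apply: ae_imp fg => x /= fg /fg ->.
Qed.

Lemma ae_ge0_int01 f : {ae leb, forall x, I01 R x -> 0 <= f x} ->
  measurable_fun (I01 R) f -> 0 <= \int[leb]_(x in I01 R) f x.
Proof.
move=> f0 mf; rewrite (@ae_eq_int01 _ (fun x => `|f x|))//.
- by apply: Rintegral_ge0.
- exact: measurableT_comp.
- by apply: ae_imp f0 => x /= h /h f0; rewrite ger0_norm.
Qed.

Lemma ae_le_int01 f g : {ae leb, forall x, I01 R x -> f x <= g x} ->
  L1 f -> L1 g ->
  \int[leb]_(x in I01 R) f x <= \int[leb]_(x in I01 R) g x.
Proof.
move=> fg Lf Lg; rewrite -subr_ge0 -int01B//; apply: ae_ge0_int01.
  by apply: ae_imp fg => x /= h /h; rewrite subr_ge0.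
exact: (L1_meas (L1B Lg Lf)).
Qed.

Lemma int01_eq0 f : {ae leb, forall x, I01 R x -> 0 <= f x} -> L1 f ->
  \int[leb]_(x in I01 R) f x = 0 -> ae_zero f.
Proof.
move=> f0 Lf; rewrite (@ae_eq_int01 _ (fun x => `|f x|)); last 3 first.
- exact: L1_meas.
- exact: L1_meas (L1_norm Lf).
- by apply: ae_imp f0 => x /= h /h f0; rewrite ger0_norm.
have hfin : (\int[leb]_(x in I01 R) (`|f x|)%:E)%E \is a fin_num.
  exact: integrable_fin_num (L1_norm Lf).
move=> h0.
have mEf : measurable_fun (I01 R) (EFin \o f) by apply/measurable_EFinP; exact: L1_meas.
have [+ _] := @ae_eq_integral_abs _ _ _ leb _ measurable_I01 _ mEf.
move=> h; have {h} := h _.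
rewrite (_ : (\int[leb]_(x in I01 R) `|(EFin \o f) x| = 0)%E); last first.
  by rewrite -(fineK hfin) -[fine _]/(\int[leb]_(x in I01 R) `|f x|)%R h0.
by move=> /(_ erefl); apply: ae_imp => x /= h /h [].
Qed.

(** Bounded jointly measurable kernels: on the unit square they satisfy the
    hypothesis of Fubini against any pair of L1 functions. *)
Definition bkernel K := measurable_fun setT (fun z : R * R => K z.1 z.2) /\
  exists C, forall x y, I01 R x -> I01 R y -> `|K x y| <= C.

Lemma measurable_restrict01 f : measurable_fun (I01 R) f ->
  measurable_fun setT (f \_ (I01 R)).
Proof. by move=> mf; apply/(measurable_restrictT _ _).1. Qed.

Lemma bkernel_meas2 K x : bkernel K -> measurable_fun setT (K x).
Proof.
by move=> [mK _]; exact: (measurableT_comp mK (measurable_pair1 x)).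
Qed.

Lemma bkernel_meas1 K y : bkernel K -> measurable_fun setT (K ^~ y).
Proof.
by move=> [mK _]; exact: (measurableT_comp mK (measurable_pair2 y)).
Qed.

Lemma bkernel_bdd2 K x : bkernel K -> I01 R x -> bdd (K x).
Proof.
move=> bK xI; split; first exact: measurable_funTS (bkernel_meas2 _ bK).
by have [_ [C hC]] := bK; exists C => y; exact: hC.
Qed.

Lemma bkernel_bdd1 K y : bkernel K -> I01 R y -> bdd (K ^~ y).
Proof.
move=> bK yI; split; first exact: measurable_funTS (bkernel_meas1 _ bK).
by have [_ [C hC]] := bK; exists C => x xI; exact: hC.
Qed.

Lemma bkernelC K : bkernel K -> bkernel (fun x y => K y x).
Proof.
move=> [mK [C hC]]; split; last by exists C => x y xI yI; exact: hC.
exact: (measurableT_comp mK (@measurable_swap _ _ _ _)).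
Qed.

Lemma L1_restrict f : L1 f -> leb.-integrable setT (EFin \o (f \_ (I01 R))).
Proof.
move=> Lf; rewrite -restrict_EFin.
exact: (proj1 (@integrable_mkcond _ _ _ leb _ (EFin \o f) measurable_I01) Lf).
Qed.

(** Cutting both functions to the interval turns integrals over the unit square
    into integrals over the whole plane, where Fubini is stated. *)
Let kfun K w f (z : R * R) : \bar R :=
  ((w \_ (I01 R)) z.1 * (K z.1 z.2 * (f \_ (I01 R)) z.2))%:E.

Let kfun_integrable K w f : bkernel K -> L1 w -> L1 f ->
  (leb \x leb)%E.-integrable setT (kfun K w f).
Proof.
move=> bK Lw Lf; have [mK [C hC]] := bK.
have mk : measurable_fun setT (kfun K w f).
  apply/measurable_EFinP; apply: measurable_funM.
    exact: (measurableT_comp (measurable_restrict01 (L1_meas Lw)) measurable_fst).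
  apply: measurable_funM => //.
  exact: (measurableT_comp (measurable_restrict01 (L1_meas Lf)) measurable_snd).
apply: (proj2 (integrable12ltyP leb leb mk)).
have LTf := L1_restrict Lf; have LTw := L1_restrict Lw.
set If : \bar R := (\int[leb]_y `|(f \_ (I01 R)) y|%:E)%E.
have If_fin : If \is a fin_num.
  exact: (integrable_fin_num measurableT (integrable_norm LTf)).
apply: (@le_lt_trans _ _
   (\int[leb]_x (`|C| * fine If * `|(w \_ (I01 R)) x|)%:E)%E); last first.
  have := @integrableZl _ _ _ leb _ measurableT (`|C| * fine If) _ (integrable_norm LTw).
  move=> /(integrable_fin_num measurableT).
  by rewrite ltey_eq => ->.
apply: ge0_le_integral => //.
- by move=> x _; exact: integral_ge0.
- have k0 z : (0 <= (abse \o kfun K w f) z)%E by exact: abse_ge0.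
  have mak : measurable_fun setT (abse \o kfun K w f) by exact: measurableT_comp.
  have := @measurable_fun_fubini_tonelli_F _ _ _ _ _ leb _ mak k0.
  exact.
- apply/measurable_EFinP; apply: measurable_funM => //.
  by apply: measurableT_comp => //; exact: measurable_restrict01 (L1_meas Lw).
move=> x _.
rewrite mulrAC EFinM fineK// -ge0_integralZl//; last first.
  by apply/measurable_EFinP; apply: measurableT_comp => //; exact: measurable_restrict01 (L1_meas Lf).
apply: ge0_le_integral => //.
- apply: measurableT_comp => //; exact: (measurableT_comp mk (measurable_pair1 x)).
- apply/measurable_EFinP; apply: measurable_funM => //.
  by apply: measurableT_comp => //; exact: measurable_restrict01 (L1_meas Lf).
move=> y _ /=; rewrite lee_fin !normrM mulrA (mulrC `|C|) !patchE.
case: ifPn => xI; last by rewrite normr0 !mul0r.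
case: ifPn => yI; last by rewrite normr0 !mulr0.
rewrite ler_wpM2r// ler_wpM2l//.
move: xI yI; rewrite !inE => xI yI.
by rewrite (le_trans (hC _ _ xI yI))// ler_norm.
Qed.

Definition kint K f x := \int[leb]_(y in I01 R) (K x y * f y).

Lemma L1_kernel K f x : bkernel K -> L1 f -> I01 R x -> L1 (fun y => K x y * f y).
Proof. by move=> bK Lf xI; apply: L1_bddM => //; exact: bkernel_bdd2. Qed.

Let kfunE K w f x : bkernel K -> L1 f ->
  (\int[leb]_y kfun K w f (x, y))%E =
  (((fun x => w x * kint K f x) \_ (I01 R)) x)%:E.
Proof.
move=> bK Lf; rewrite patchE /kfun/= patchE; case: ifPn => [|xI]; last first.
  by under eq_integral do rewrite mul0r; rewrite integral0.
rewrite inE => xI; have LKf := L1_kernel bK Lf xI.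
rewrite EFinM /kint /Rintegral fineK; last exact: integrable_fin_num LKf.
rewrite -(@integralZl _ _ _ leb _ measurable_I01 _ LKf).
rewrite [RHS]integral_mkcond; apply: eq_integral => y _.
by rewrite !patchE; case: ifPn => // yI; rewrite !mulr0.
Qed.

Let kfunC K w f x y : kfun K w f (x, y) = kfun (fun x y => K y x) f w (y, x).
Proof. by rewrite /kfun /=; congr EFin; ring. Qed.

(** Every exchange of integrals in the proof is this one: a bounded kernel
    acting on one side of an L1 pairing acts by its transpose on the other. *)
Lemma kint_fubini K w f : bkernel K -> L1 w -> L1 f ->
  \int[leb]_(x in I01 R) (w x * kint K f x) =
  \int[leb]_(y in I01 R) (f y * kint (fun x y => K y x) w y).
Proof.
move=> bK Lw Lf; rewrite Rintegral_mkcond [RHS]Rintegral_mkcond /Rintegral.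
have kE K' w' f' : bkernel K' -> L1 f' ->
    (\int[leb]_x (((fun x => w' x * kint K' f' x) \_ (I01 R)) x)%:E =
     \int[leb]_x \int[leb]_y kfun K' w' f' (x, y))%E.
  by move=> bK' Lf'; apply: eq_integral => x _; rewrite kfunE.
rewrite (kE K w f bK Lf) (kE (fun x y => K y x) f w (bkernelC bK) Lw).
rewrite (@Fubini _ _ _ _ _ leb leb _ (kfun_integrable bK Lw Lf)).
congr fine; apply: eq_integral => y _; apply: eq_integral => x _.
exact: kfunC.
Qed.

Lemma bdd_kint K f : bkernel K -> L1 f -> bdd (kint K f).
Proof.
move=> bK Lf; have [_ [C hC]] := bK; split; last first.
  exists (`|C| * \int[leb]_(y in I01 R) `|f y|) => x xI.
  have LKf := L1_kernel bK Lf xI.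
  apply: (le_trans (@le_normr_Rintegral _ _ _ leb _ _ measurable_I01 LKf)).
  rewrite -int01Z; last exact: L1_norm.
  apply: le_Rintegral => //; [exact: L1_norm LKf|exact: L1Z (L1_norm Lf)|].
  move=> y yI; rewrite normrM ler_wpM2r//.
  by rewrite (le_trans (hC _ _ xI yI))// ler_norm.
have L1one : L1 (fun _ : R => 1 : R) by exact/bdd_L1/bdd_cst.
have := @measurable_fubini_F _ _ _ _ _ leb leb _ (kfun_integrable bK L1one Lf).
move=> mF; have : measurable_fun setT
    (EFin \o ((fun x => 1 * kint K f x) \_ (I01 R))).
  by apply: eq_measurable_fun mF => x _; exact: kfunE.
move=> /measurable_EFinP /(measurable_restrictT _ measurable_I01).2.
by under eq_fun do rewrite mul1r.
Qed.
End UnitInterval.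

(** * Iterated primitives *)

Section Cumulative.
Context {R : realType}.
Local Notation leb := (@lebesgue_measure R).
Implicit Types (f g w F : R -> R) (K : R -> R -> R) (p : {poly R}) (a b x t : R).

Lemma int01_itv f a b : 0 <= a -> b <= 1 ->
  \int[leb]_(x in `]a, b[) f x =
  \int[leb]_(x in I01 R) ((a < x)%R%:R * (x < b)%R%:R * f x).
Proof.
move=> a0 b1; rewrite Rintegral_mkcond [RHS]Rintegral_mkcond.
apply: eq_Rintegral => x _; rewrite !patchE !mem_setE /I01 !in_itv/=.
case: (ltP a x) => ax; last by rewrite !mul0r if_same.
case: (ltP x b) => xb; last by rewrite mulr0 mul0r if_same.
by rewrite (le_lt_trans a0 ax) (lt_le_trans xb b1) !mul1r.
Qed.

(** Subintervals are encoded by indicator factors, so that all integrals have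
    the same domain and can be compared under one integral sign. *)
Lemma ftc01 F f a b : 0 <= a -> a <= b -> b <= 1 ->
  (forall x, is_derive x 1 F (f x)) -> continuous f ->
  \int[leb]_(x in I01 R) ((a < x)%R%:R * (x < b)%R%:R * f x) = F b - F a.
Proof.
move=> a0 ab b1 dF cf; rewrite -int01_itv//.
move: ab; rewrite le_eqVlt => /predU1P[<-|ab].
  by rewrite set_itvoo0 Rintegral_set0 subrr.
have cF : continuous F.
  move=> x; apply/differentiable_continuous/derivable1_diffP.
  by have [] := dF x.
have dLR : derivable_oo_LRcontinuous F a b.
  split=> [x _||]; first by have [] := dF x.
    exact/cvg_at_right_filter/cF.
  exact/cvg_at_left_filter/cF.
have dFE : {in `]a, b[, derive1 F =1 f}.
  by move=> x _; rewrite derive1E; have [_ ->] := dF x.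
have E := continuous_FTC2 ab (continuous_subspaceT cf) dLR dFE.
rewrite /Rintegral -(@integral_itv_bndoo _ a b (EFin \o f) true false); last first.
  apply/measurable_EFinP; apply: measurable_funTS.
  exact: continuous_measurable_fun.
by rewrite E.
Qed.

Lemma I01_sub : I01 R `<=` `[0, 1]%classic.
Proof. exact: subset_itv_oo_cc. Qed.

Lemma bdd_cont01 f : {within `[0, 1]%classic, continuous f} -> bdd f.
Proof.
move=> cf; split.
  apply: measurable_funS I01_sub _; first exact: measurable_itv.
  by apply: subspace_continuous_measurable_fun => //; exact: measurable_itv.
have cnf : {within `[0, 1]%classic, continuous (fun x => `|f x|)}.
  by move=> x; apply: continuous_comp; [exact: cf|exact: norm_continuous].
have [c _ hc] := EVT_max ler01 cnf.
by exists `|f c| => x /I01_sub; exact: hc.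
Qed.

Lemma int01_poly p a b : 0 <= a -> a <= b -> b <= 1 ->
  \int[leb]_(x in I01 R) ((a < x)%R%:R * (x < b)%R%:R * p^`().[x]) =
  p.[b] - p.[a].
Proof.
move=> a0 ab b1; apply: (@ftc01 (horner p) (horner p^`())) => //.
exact: continuous_horner.
Qed.

(** Cauchy's kernel: integrating against it is (n+1)-fold integration from 0. *)
Definition Jker n (x t : R) : R := (t < x)%R%:R * ((x - t) ^+ n / n`!%:R).

Lemma measurable_step d (T : measurableType d) (f g : T -> R) : measurable_fun setT f ->
  measurable_fun setT g ->
  measurable_fun setT (fun z => (f z < g z)%R%:R : R).
Proof.
move=> mf mg.
rewrite (_ : (fun z => _) = (fun z => if (f z < g z)%R then 1 else 0)); last first.
  by apply/funext => z; case: ifP.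
apply: measurable_fun_ifT => //; exact: measurable_fun_ltr.
Qed.

Lemma bdd_stepl x : bdd (fun t => (t < x)%R%:R : R).
Proof.
split; last by exists 1 => s _; case: (_ < _); rewrite ?normr1 ?normr0.
by apply: measurable_funTS; apply: measurable_step => //; exact: measurable_cst.
Qed.

Lemma bdd_stepr x : bdd (fun t => (x < t)%R%:R : R).
Proof.
split; last by exists 1 => s _; case: (_ < _); rewrite ?normr1 ?normr0.
by apply: measurable_funTS; apply: measurable_step => //; exact: measurable_cst.
Qed.

Lemma bkernelM K K' : bkernel K -> bkernel K' -> bkernel (fun x y => K x y * K' x y).
Proof.
move=> [mK [C hC]] [mK' [C' hC']]; split; first exact: measurable_funM.
exists (C * C') => x y xI yI; rewrite normrM ler_pM//; [exact: hC|exact: hC'].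
Qed.

Lemma bkernelD K K' : bkernel K -> bkernel K' -> bkernel (fun x y => K x y + K' x y).
Proof.
move=> [mK [C hC]] [mK' [C' hC']]; split; first exact: measurable_funD.
exists (C + C') => x y xI yI; rewrite (le_trans (ler_normD _ _))// lerD//.
  exact: hC.
exact: hC'.
Qed.

Lemma bkernel_step : bkernel (fun x t : R => (t < x)%R%:R : R).
Proof.
split; first by apply: measurable_step; [exact: measurable_snd|exact: measurable_fst].
by exists 1 => x y _ _; case: (_ < _); rewrite ?normr1 ?normr0.
Qed.

Lemma bkernel_cst (c : R) : bkernel (fun _ _ : R => c).
Proof. by split; [exact: measurable_cst|exists `|c|]. Qed.

Lemma bkernel_fst : bkernel (fun x _ : R => x).
Proof.
split; first exact: measurable_fst.
by exists 1 => x y; rewrite I01E => /andP[x0 x1] _; rewrite gtr0_norm// ltW.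
Qed.

Lemma bkernel_snd : bkernel (fun _ y : R => y).
Proof. exact: bkernelC bkernel_fst. Qed.

Lemma bkernelX K n : bkernel K -> bkernel (fun x y => K x y ^+ n).
Proof.
move=> bK; elim: n => [|n IH].
  by under eq_fun do under eq_fun do rewrite expr0; exact: bkernel_cst.
by under eq_fun do under eq_fun do rewrite exprS; exact: bkernelM.
Qed.

Lemma bkernelB K K' : bkernel K -> bkernel K' -> bkernel (fun x y => K x y - K' x y).
Proof.
move=> bK bK'; under eq_fun do under eq_fun do rewrite -mulN1r.
by apply: bkernelD => //; apply: bkernelM => //; exact: bkernel_cst.
Qed.

Lemma bkernel_Jker n : bkernel (Jker n).
Proof.
apply: bkernelM; first exact: bkernel_step.
apply: bkernelM; last exact: bkernel_cst.
by apply: bkernelX; apply: bkernelB; [exact: bkernel_fst|exact: bkernel_snd].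
Qed.

Definition J n w := kint (Jker n) w.

Lemma J_itv n w x : 0 < x < 1 ->
  \int[leb]_(t in `]0, x[) ((x - t) ^+ n / n`!%:R * w t) = J n w x.
Proof.
move=> /andP[x0 x1]; rewrite int01_itv ?lexx ?ltW//.
apply: eq_int01 => t /andP[t0 _]; rewrite t0 mul1r /Jker; ring.
Qed.

Lemma J0E w x : J 0 w x = \int[leb]_(t in I01 R) ((t < x)%R%:R * w t).
Proof. by apply: eq_int01 => t _; rewrite /Jker expr0 fact0 divr1 mulr1. Qed.

Lemma J_eval0 n w : J n w 0 = 0.
Proof.
rewrite /J /kint (@eq_int01 _ _ (fun=> 0)).
  exact: int01_cst.
by move=> t /andP[t0 _]; rewrite /Jker ltNge (ltW t0)/= mulr0n !mul0r.
Qed.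

Lemma bdd_J n w : L1 w -> bdd (J n w).
Proof. by move=> Lw; apply: bdd_kint => //; exact: bkernel_Jker. Qed.

Lemma fact_unit m : (m`!)%:R != 0 :> R.
Proof. by rewrite pnatr_eq0 -lt0n fact_gt0. Qed.

(** Divided powers: derivation only shifts the index, which removes all
    factorials from the computations with iterated primitives. *)
Definition dpow m t : {poly R} := ((m`!)%:R)^-1 *: ('X - t%:P) ^+ m.

Lemma dpowE m t s : (dpow m t).[s] = (s - t) ^+ m / (m`!)%:R.
Proof. by rewrite /dpow !hornerE mulrC. Qed.

Lemma deriv_dpow m t : (dpow m.+1 t)^`() = dpow m t.
Proof.
rewrite /dpow derivZ deriv_exp derivB derivX derivC subr0 mul1r /=.
rewrite -scalerMnr scalerMnl; congr (_ *: _).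
by rewrite -mulr_natr factS natrM invfM mulrAC mulVf ?mul1r// pnatr_eq0.
Qed.

(** Integrating Cauchy's kernel once in its first variable raises its order by
    one. *)
Lemma Jker_convol n x t : x <= 1 -> 0 < t ->
  \int[leb]_(s in I01 R) (Jker n s t * (s < x)%R%:R) = Jker n.+1 x t.
Proof.
move=> x1 t0; rewrite /Jker.
case: (ltP t x) => tx; last first.
  rewrite mul0r (@eq_int01 _ _ (fun=> 0)); first exact: int01_cst.
  move=> s /andP[s0 s1]; case: (ltP t s) => ts; last by rewrite !mul0r.
  by rewrite ltNge (le_trans tx (ltW ts))/= mulr0n mulr0.
rewrite (@eq_int01 _ _ (fun s => (t < s)%R%:R * (s < x)%R%:R * (dpow n.+1 t)^`().[s])).
  by rewrite (int01_poly _ (ltW t0) (ltW tx) x1) !dpowE subrr expr0n/= mul0r subr0 mul1r.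
by move=> s _; rewrite deriv_dpow dpowE mulrAC.
Qed.

Lemma J0_J n w x : L1 w -> x <= 1 -> J 0 (J n w) x = J n.+1 w x.
Proof.
move=> Lw x1; rewrite J0E.
have Lc : L1 (fun s : R => (s < x)%R%:R : R) by exact: bdd_L1 (bdd_stepl x).
rewrite kint_fubini//; last exact: bkernel_Jker.
apply: eq_int01 => t /andP[t0 t1]; rewrite mulrC; congr (_ * _).
exact: Jker_convol.
Qed.

(** Integration by parts when the primitive is only absolutely continuous:
    Fubini on the triangle [t < x]. *)
Lemma J0_parts w F f : L1 w -> (forall x, is_derive x 1 F (f x)) -> continuous f ->
  F 1 = 0 ->
  \int[leb]_(x in I01 R) (J 0 w x * f x) = - \int[leb]_(x in I01 R) (w x * F x).
Proof.
move=> Lw dF cf F1.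
have cF : continuous F.
  move=> x; apply/differentiable_continuous/derivable1_diffP.
  by have [] := dF x.
have bF : bdd F by exact/bdd_cont01/continuous_subspaceT.
have bf : bdd f by exact/bdd_cont01/continuous_subspaceT.
rewrite (@eq_int01 _ _ (fun x => f x * J 0 w x)); last by move=> x _; rewrite mulrC.
rewrite kint_fubini//; [|exact: bkernel_Jker|exact: bdd_L1].
rewrite -mulN1r -int01Z; last first.
  by under eq_fun do rewrite mulrC; apply: L1_bddM.
apply: eq_int01 => t /andP[t0 t1]; rewrite mulN1r -mulrN; congr (_ * _).
have := ftc01 (ltW t0) (ltW t1) (lexx 1) dF cf; rewrite F1 sub0r => <-.
by apply: eq_int01 => s /andP[s0 s1]; rewrite /Jker expr0 fact0 divr1 mulr1 s1 mulr1.
Qed.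

Lemma J0_param w x : L1 w -> 0 <= x <= 1 ->
  parameterized_integral leb 0 x (w \_ (I01 R)) = J 0 w x.
Proof.
move=> Lw /andP[x0 x1]; rewrite /parameterized_integral /Rintegral.
rewrite (@integral_itv_bndoo _ 0 x (EFin \o (w \_ (I01 R))) true false); last first.
  apply/measurable_EFinP; apply: measurable_funTS.
  exact: measurable_restrict01 (L1_meas Lw).
rewrite -[LHS]/(\int[leb]_(t in `]0, x[) (w \_ (I01 R)) t).
rewrite int01_itv// J0E; apply: eq_int01 => t t01.
rewrite patchE mem_set; last by rewrite I01E.
by move: t01 => /andP[-> _]; rewrite mul1r.
Qed.

Lemma J0_cont w : L1 w -> {within `[0, 1]%classic, continuous (J 0 w)}.
Proof.
move=> Lw; pose w0 := w \_ (I01 R).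
have Lw0 : leb.-integrable `[0, 1]%classic (EFin \o w0).
  by apply: (@integrableS _ _ _ leb setT) => //; exact: L1_restrict.
have := parameterized_integral_continuous ler01 Lw0.
apply: subspace_eq_continuous => x; rewrite inE/= in_itv/= => x01.
exact: J0_param.
Qed.
End Cumulative.

(** * Smooth bumps *)

Section Bump.
Context {R : realType}.
Implicit Types (a b c x y : R) (p q s : {poly R}) (f g : R -> R).

(** The derivatives of exp (- c / y), extended by 0 to y <= 0, are linear
    combinations of these functions. *)
Definition flat c n y : R := if 0 < y then (y^-1) ^+ n * expR (- c * y^-1) else 0.

Lemma flat_le0 c n y : y <= 0 -> flat c n y = 0.
Proof. by rewrite /flat ltNge => ->. Qed.

(** At the junction point 0 no computation of the derivative is needed: a
    function dominated by a parabola is flat there. *)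
Lemma is_derive_sqr_bound f C : (forall y, `|f y| <= C * y ^+ 2) ->
  is_derive (0 : R) (1 : R) f 0.
Proof.
move=> fC; have f0 : f 0 = 0.
  by apply/eqP; rewrite -normr_le0; have := fC 0; rewrite expr0n/= mulr0.
have C0 : 0 <= C by have := fC 1; rewrite expr1n mulr1; apply: le_trans.
have cv : (fun h : R => h^-1 *: (f (h *: 1 + 0) - f 0)) @ 0^' --> (0 : R).
  apply/cvgrPdist_le => e e0; near=> h.
  have h0 : h != 0 by near: h; exact: nbhs_dnbhs_neq.
  rewrite f0 subr0 addr0 sub0r normrN /GRing.scale/= mulr1 normrM normfV.
  rewrite ler_pdivrMl ?normr_gt0//.
  apply: le_trans (fC h) _; rewrite -real_normK ?num_real// expr2 mulrA mulrC.
  rewrite ler_wpM2l//.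
  have : `|h| <= e / (C + 1).
    near: h; apply: dnbhs0_le; rewrite divr_gt0// ltr_wpDl//.
  rewrite ler_pdivlMr ?ltr_wpDl//; apply: le_trans.
  by rewrite mulrC ler_wpM2l// lerDl.
split; first by apply/cvg_ex; exists 0.
exact/cvg_lim.
Unshelve. all: by end_near. Qed.

Lemma flat_bound c n : 0 < c -> exists C, forall y, `|flat c n y| <= C * y ^+ 2.
Proof.
(* From exp z >= z ^ (n + 2) / (n + 2)! at z = c / y. *)
move=> c0; exists ((n.+2)`!%:R / c ^+ n.+2) => y; rewrite /flat.
have C0 : 0 <= (n.+2)`!%:R / c ^+ n.+2 by rewrite divr_ge0// exprn_ge0// ltW.
case: ifPn => y0; last by rewrite normr0 mulr_ge0// sqr_ge0.
rewrite ger0_norm; last by rewrite mulr_ge0 ?expR_ge0// exprn_ge0// invr_ge0 ltW.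
rewrite mulNr expRN exprVn.
have cy0 : 0 <= c * y^-1 by rewrite mulr_ge0 ?invr_ge0 ?ltW.
have := expR_ge1Dxn n.+1 cy0; set E := expR _ => hE.
have E0 : 0 < E := expR_gt0 _.
have : (c * y^-1) ^+ n.+2 / (n.+2)`!%:R <= E by apply: le_trans hE; rewrite lerDr.
rewrite ler_pdivrMr ?ltr0n ?fact_gt0// exprMn exprVn.
have yn0 : 0 < y ^+ n by rewrite exprn_gt0.
have cn0 : 0 < c ^+ n.+2 by rewrite exprn_gt0.
have yE : y ^+ n.+2 = y ^+ n * y ^+ 2 by rewrite -exprD addn2.
rewrite ler_pdivrMr ?exprn_gt0// yE => h.
rewrite -invfM -div1r ler_pdivrMr ?mulr_gt0//.
rewrite (_ : _ * (_ * E) = E * (n.+2)`!%:R * (y ^+ n * y ^+ 2) / c ^+ n.+2); last by ring.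
by rewrite ler_pdivlMr// mul1r.
Qed.

(** For y > 0 this is the product rule in the variable 1 / y; no new functions
    appear, so the family is stable under derivation. *)
Lemma is_derive_flat c n y : 0 < c ->
  is_derive y (1 : R) (flat c n) (- n%:R * flat c n.+1 y + c * flat c n.+2 y).
Proof.
move=> c0; have [y0|y0|->] := ltgtP y 0.
- rewrite !(flat_le0 _ _ (ltW y0)) !mulr0 addr0.
  apply: (@near_eq_is_derive _ _ _ (cst 0 : R -> R)).
  near=> z; rewrite flat_le0//; apply: ltW; near: z; exact: lt_nbhsl.
- pose G z : R := z ^+ n * expR (- c * z).
  have dG : is_derive (y^-1) (1 : R) G
     (n%:R * y^-1 ^+ n.-1 * expR (- c * y^-1) + y^-1 ^+ n * (expR (- c * y^-1) * - c)).
    have dX : is_derive y^-1 (1 : R) (fun z : R => z ^+ n) (n%:R * y^-1 ^+ n.-1).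
      have := is_derive_poly 'X^n (y^-1 : R).
      rewrite derivXn hornerMn hornerXn mulr_natl.
      by congr (is_derive _ _ _ _); apply/funext => z; rewrite hornerXn.
    have dl : is_derive y^-1 (1 : R) (fun z : R => - c * z) (- c).
      have := is_derive_poly (- c *: 'X) (y^-1 : R).
      rewrite derivZ derivX !hornerE.
      by congr (is_derive _ _ _ _); apply/funext => z; rewrite !hornerE.
    have := is_deriveM dX (is_derive1_comp (is_derive_expR (- c * y^-1)) dl).
    by move=> d; apply: is_derive_eq d _; rewrite /GRing.scale/=; ring.
  have dinv : is_derive y (1 : R) (fun z : R => z^-1) (- y ^- 2).
    have := @is_deriveV R id y 1 1 _ (is_derive_id y 1).
    by rewrite gt_eqF// => /(_ isT); rewrite /GRing.scale/= mulr1.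
  have dc := is_derive1_comp dG dinv.
  apply: (@near_eq_is_derive _ _ _ (G \o (fun z => z^-1))).
    near=> z; have z0 : 0 < z by near: z; exact: lt_nbhsr.
    by rewrite /flat z0.
  apply: is_derive_eq dc _; rewrite /flat y0 -!exprVn.
  case: n {G dG} => [|n]/=.
    by ring.
  by rewrite !exprS !expr0; ring.
- have [C hC] := flat_bound n c0.
  apply: is_derive_eq (is_derive_sqr_bound hC) _.
  by rewrite !flat_le0// !mulr0 addr0.
Unshelve. all: by end_near. Qed.

(** A family closed under derivation after substituting a polynomial s. The
    two powers of 1 / s created by a derivation are absorbed in the index, which
    is why the coefficient in the next lemma carries s ^+ 2. *)
Definition flatpoly c p s n x := p.[x] * flat c n s.[x].

Lemma is_derive_flatpoly c p s n x : 0 < c -> is_derive x (1 : R) (flatpoly c p s n)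
  (flatpoly c (p^`() * s ^+ 2 - n%:R *: (p * s^`() * s) + c *: (p * s^`())) s n.+2 x).
Proof.
move=> c0.
have ds := is_derive1_comp (is_derive_flat n s.[x] c0) (is_derive_poly s x).
have d := is_deriveM (is_derive_poly p x) ds.
apply: is_derive_eq d _; rewrite /flatpoly /GRing.scale/=.
rewrite !(hornerD, hornerN, hornerM, hornerZ, horner_exp).
rewrite /flat; case: ifP => s0; last by ring.
have sn0 : s.[x] != 0 by rewrite gt_eqF.
by rewrite !exprSr; field; exact: sn0.
Qed.

Lemma derivable_flatpoly c p s n : 0 < c ->
  forall m x, derivable (derive1n m (flatpoly c p s n)) x 1.
Proof.
move=> c0 m x; suff [q [k ->]] : exists q k,
    derive1n m (flatpoly c p s n) = flatpoly c q s k.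
  by have [] := is_derive_flatpoly q s k x c0.
elim: m {x} => [|m [q [k IH]]]; first by exists p, n.
rewrite derive1nS IH; eexists _, k.+2; apply/funext => x.
by rewrite derive1E; have [_ ->] := is_derive_flatpoly q s k x c0.
Qed.

Definition hump a b : {poly R} := ('X - a%:P) * (b%:P - 'X).

Lemma hump_gt0 a b x : a < b -> (0 < (hump a b).[x]) = (a < x < b).
Proof.
move=> ab; rewrite /hump !hornerE; apply/idP/idP => [|/andP[ax xb]]; last first.
  by rewrite mulr_gt0// subr_gt0.
have [ax|xa] := ltP a x; have [xb|bx] := ltP x b => //=; nra.
Qed.

(** The function exp (- c / ((x - a) (b - x))) on ]a, b[. Letting c tend to 0
    gives the indicator of ]a, b[, so that no rescaling is needed to
    approximate indicators by test functions. *)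
Definition bump a b c := flatpoly c 1 (hump a b) 0.

Lemma bumpE a b c x : a < b ->
  bump a b c x = if a < x < b then expR (- c * ((hump a b).[x])^-1) else 0.
Proof.
by move=> ab; rewrite /bump /flatpoly /flat hornerE mul1r hump_gt0// expr0 mul1r.
Qed.

Lemma test_function_supp f a b : 0 < a -> b < 1 -> 
  (forall n x, derivable (derive1n n f) x 1) ->
  (forall x, f x != 0 -> a <= x <= b) -> test_function f.
Proof.
move=> a0 b1 sf fab.
have sub : closure [set x | f x != 0] `<=` `[a, b]%classic.
  have -> : `[a, b]%classic = closure `[a, b]%classic.
    by apply/closure_id; exact: itv_closed.
  by apply: closureS => x /= /fab; rewrite in_itv.
split => //.
  by apply: subclosed_compact sub; [exact: closed_closure|exact: segment_compact].
move=> x /sub; rewrite /I01 /= !in_itv/= => /andP[ax xb].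
by rewrite (lt_le_trans a0 ax) (le_lt_trans xb b1).
Qed.

Lemma test_bump a b c : 0 < c -> 0 < a -> a < b -> b < 1 -> test_function (bump a b c).
Proof.
move=> c0 a0 ab b1; apply: (test_function_supp a0 b1); first exact: derivable_flatpoly.
move=> x; rewrite bumpE//; case: ifP => [/andP[ax xb] _|_]; last by rewrite eqxx.
by rewrite !ltW.
Qed.

End Bump.

(** * The fundamental lemma of the calculus of variations *)

Section FundamentalLemma.
Context {R : realType}.
Local Notation leb := (@lebesgue_measure R).
Implicit Types (a b c x y : R) (f g v w : R -> R).

Lemma bump_ge0 a b c x : 0 <= bump a b c x.
Proof.
rewrite /bump /flatpoly hornerE mul1r /flat; case: ifP => // h.
by rewrite mulr_ge0 ?expR_ge0// exprn_ge0// invr_ge0 ltW.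
Qed.

Lemma bump_le1 a b c x : a < b -> 0 < c -> bump a b c x <= 1.
Proof.
move=> ab c0; rewrite bumpE//; case: ifP => // h.
by rewrite -expR0 ler_expR mulNr oppr_le0 mulr_ge0 ?(ltW c0)// invr_ge0 ltW ?hump_gt0.
Qed.

Lemma bump_cvg a b x : a < b ->
  bump a b (n.+1%:R)^-1 x @[n --> \oo] --> ((a < x)%R%:R * (x < b)%R%:R : R).
Proof.
move=> ab; under eq_fun do rewrite bumpE//.
case: (ltP a x) => ax; last by rewrite /= mul0r; exact: cvg_cst.
case: (ltP x b) => xb; last by rewrite /= mulr0; exact: cvg_cst.
rewrite /= mulr1.
have cv0 : (fun n => - (n.+1%:R)^-1 * ((hump a b).[x])^-1 : R) @ \oo --> (0 : R).
  under eq_fun do rewrite mulNr.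
  rewrite -oppr0; apply: cvgN; rewrite -[X in _ --> X](mul0r ((hump a b).[x])^-1).
  by apply: cvgMl; exact: cvg_harmonic.
have := (@cvg_comp _ _ _ (fun n => - (n.+1%:R)^-1 * ((hump a b).[x])^-1) (@expR R)
  _ _ _ cv0 (@continuous_expR R 0)).
by rewrite expR0; exact.
Qed.

Lemma bdd_bump a b c : a < b -> 0 < c -> bdd (bump a b c).
Proof.
move=> ab c0; apply/bdd_cont01/continuous_subspaceT => x.
apply/differentiable_continuous/derivable1_diffP.
exact: (@derivable_flatpoly R c 1 (hump a b) 0%N c0 0%N x).
Qed.

Lemma bdd_step2 a b : bdd (fun x => (a < x)%R%:R * (x < b)%R%:R : R).
Proof.
by apply: bddM; [exact: bdd_stepr|exact: bdd_stepl].
Qed.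

(** Dominated convergence along c = 1 / (n + 1). *)
Lemma int_itv_eq0 f a b : L1 f -> a < b ->
  (forall c, 0 < c -> \int[leb]_(x in I01 R) (f x * bump a b c x) = 0) ->
  \int[leb]_(x in I01 R) ((a < x)%R%:R * (x < b)%R%:R * f x) = 0.
Proof.
move=> Lf ab h.
pose fn n x := (f x * bump a b (n.+1%:R)^-1 x)%:E.
pose f0 x := (f x * ((a < x)%R%:R * (x < b)%R%:R))%:E.
have n0 n : 0 < (n.+1%:R)^-1 :> R by rewrite invr_gt0.
have Lfn n : L1 (fun x => f x * bump a b (n.+1%:R)^-1 x).
  by under eq_fun do rewrite mulrC; apply: L1_bddM => //; exact: bdd_bump.
have Lf0 : L1 (fun x => f x * ((a < x)%R%:R * (x < b)%R%:R)).
  by under eq_fun do rewrite mulrC; apply: L1_bddM => //; exact: bdd_step2.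
have [] := @dominated_convergence _ _ _ leb _ measurable_I01 fn f0
  (fun x => `|f x|%:E).
- by move=> n; exact: measurable_int (Lfn n).
- exact: measurable_int Lf0.
- apply: aeW => x _; apply/fine_cvgP; split; first exact: nearW.
  by apply: cvgMr; exact: bump_cvg.
- exact: L1_norm Lf.
- apply: aeW => x n _; rewrite lee_fin normrM ler_piMr//.
  by rewrite ger0_norm ?bump_ge0// bump_le1.
move=> _ _ cv.
have E n : (\int[leb]_(x in I01 R) fn n x)%E = 0%E.
  by rewrite (int01_EFin (Lfn n)) h.
have I0 : (\int[leb]_(x in I01 R) f0 x = 0)%E.
  apply: (cvg_unique _ cv) => //; rewrite (_ : [sequence _]_n = cst 0%E).
    exact: cvg_cst.
  by apply/funext => n; exact: E.
rewrite (@eq_int01 _ _ (fun x => f x * ((a < x)%R%:R * (x < b)%R%:R))).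
  by rewrite /Rintegral I0.
by move=> x _; rewrite mulrC.
Qed.

(** Fundamental lemma of the calculus of variations. Testing against bumps
    shows that f has zero integral over every subinterval; its indefinite
    integral is then locally constant, and by Lebesgue differentiation its
    derivative is f almost everywhere. *)
Lemma ae_zero_flcv f : L1 f ->
  (forall a b c, 0 < a -> a < b -> b < 1 -> 0 < c ->
     \int[leb]_(x in I01 R) (f x * bump a b c x) = 0) ->
  ae_zero f.
Proof.
move=> Lf h; pose f0 := f \_ (I01 R).
have Lf0 : leb.-integrable setT (EFin \o f0) by exact: L1_restrict.
have iy y : leb.-integrable `]-oo, y]%classic (EFin \o f0).
  by apply: (@integrableS _ _ _ leb setT).
have locf : locally_integrable [set: R] f0.
  exact: (integrable_locally measurable_I01 Lf).
have := FTC1Ny iy locf; apply: ae_imp => x /= + x01 => -[_].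
rewrite /f0 patchE mem_set// => <-.
rewrite derive1E.
transitivity ('D_1 (cst (\int[leb]_(t in `]-oo, x]) f0 t) : R -> R) x); last first.
  exact: derive_cst.
have const y z : 0 < y -> y < z -> z < 1 ->
    \int[leb]_(t in `]-oo, z]) f0 t = \int[leb]_(t in `]-oo, y]) f0 t.
  move=> y0 yz z1; apply/eqP; rewrite -subr_eq0; apply/eqP.
  rewrite Rintegral_itvB//; last by rewrite bnd_simp ltW.
  rewrite -Rintegral_itv_bndo_bndc; last by apply: (@integrableS _ _ _ leb setT).
  rewrite int01_itv ?ltW//.
  rewrite (@eq_int01 _ _ (fun x => (y < x)%R%:R * (x < z)%R%:R * f x)).
    by apply: int_itv_eq0 => // c c0; apply: h.
  by move=> t t01; rewrite /f0 patchE mem_set// I01E.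
have /andP[x0 x1] : 0 < x < 1 by rewrite -I01E.
(* The indefinite integral is constant on the open unit interval. *)
apply: near_eq_derive; near=> y.
have : I01 R y.
  by near: y; apply: open_nbhs_nbhs; split => //; exact: interval_open.
rewrite I01E => /andP[y0 y1] /=.
by have [yx|xy|->//] := ltgtP y x; [rewrite -(const y x)|exact: const].
Unshelve. all: by end_near. Qed.
End FundamentalLemma.

(** * The lemma of du Bois-Reymond *)

Section DuBoisReymond.
Context {R : realType}.
Local Notation leb := (@lebesgue_measure R).
Implicit Types (a b c x y : R) (f g v w : R -> R).

Definition smooth f := forall n x, derivable (derive1n n f) x 1.

Lemma derive1n_lin f g c n : smooth f -> smooth g ->
  derive1n n (fun x => f x - c * g x) =
  fun x => derive1n n f x - c * derive1n n g x.
Proof.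
move=> sf sg; elim: n => // n IH; rewrite !derive1nS IH; apply/funext => x.
rewrite derive1E.
have [df dg] := (derivableP (sf n x), derivableP (sg n x)).
have d := is_deriveB df (is_deriveZ c dg).
by rewrite (@derive_val _ _ _ _ _ _ _ d) !derive1E.
Qed.

Lemma smooth_lin f g c : smooth f -> smooth g -> smooth (fun x => f x - c * g x).
Proof.
move=> sf sg n x; rewrite derive1n_lin//.
have [df dg] := (derivableP (sf n x), derivableP (sg n x)).
by have [] := is_deriveB df (is_deriveZ c dg).
Qed.

Lemma smooth_cont f : smooth f -> continuous f.
Proof.
move=> sf x; apply/differentiable_continuous/derivable1_diffP; exact: (sf 0%N x).
Qed.

(** A test function of integral zero is the derivative of a test function: its
    primitive vanishes to the left of the support, and to the right of it
    because the total integral is zero. *)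
Lemma primitive_test f a b : 0 < a -> a < b -> b < 1 -> smooth f ->
  (forall x, f x != 0 -> a < x < b) -> \int[leb]_(x in I01 R) f x = 0 ->
  exists2 F, test_function F & derive1 F = f.
Proof.
move=> a0 ab b1 sf fab f0; have cf := smooth_cont sf.
have fE x : ~~ (a < x < b) -> f x = 0.
  by move=> xab; apply/eqP; apply: contraNT xab => /fab.
have bf : bdd f by exact/bdd_cont01/continuous_subspaceT.
have frE : f \_ (I01 R) = f.
  apply/funext => x; rewrite patchE; case: ifPn => // /negP; rewrite inE I01E => xI.
  rewrite fE//; apply/negP => /andP[ax xb]; apply: xI.
  by rewrite (lt_trans a0 ax) (lt_trans xb b1).
have iy y : leb.-integrable `]-oo, y]%classic (EFin \o f).
  apply: (@integrableS _ _ _ leb setT) => //.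
  by rewrite -frE; exact: (L1_restrict (bdd_L1 bf)).
pose F y := \int[leb]_(t in `]-oo, y]) f t.
have dF x : derivable F x 1 /\ derive1 F x = f x.
  have xu : x < x + 1 by rewrite ltrDl.
  have := @continuous_FTC1 _ f -oo%O x (x + 1) xu (iy _).
  by move=> /(_ (ltNyr _) (cf x)).
have dFE : derive1 F = f by apply/funext => x; have [] := dF x.
exists F => //; apply: (test_function_supp a0 b1).
  case=> [|n] x; first by have [] := dF x.
  by rewrite /derive1n iterSr dFE; exact: sf.
move=> x Fx; apply/andP; split; rewrite leNgt; apply: contra_neqN Fx => xab.
  rewrite /F Rintegral_mkcond -[RHS](Rintegral_set0 leb f) [RHS]Rintegral_mkcond.
  apply: eq_Rintegral => t _; rewrite !patchE !mem_setE in_itv/= in_set0.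
  case: ifPn => // tx; rewrite fE//; apply/negP => /andP[at_ _].
  by have := lt_le_trans at_ tx; rewrite ltNge ltW.
rewrite -f0 /F Rintegral_mkcond [RHS]Rintegral_mkcond frE.
apply: eq_Rintegral => t _; rewrite !patchE !mem_setE in_itv/=.
case: ifPn => //; rewrite -ltNge => xt; rewrite fE//; apply/negP => /andP[_ tb].
by have := lt_trans (lt_trans xab xt) tb; rewrite ltxx.
Qed.

(** A nonzero value, even at an endpoint, would persist on a nonempty open
    subinterval, which is not negligible. *)
Lemma ae_zero_cont f : {within `[0, 1]%classic, continuous f} -> ae_zero f ->
  forall x, 0 <= x <= 1 -> f x = 0.
Proof.
move=> cf [N [mN N0 fN]] x x01; apply: contrapT => /eqP fx0.
have [/= x0 x1] := andP x01.
have [e e0 he] : exists2 e, 0 < e & forall y, `|x - y| < e -> 0 <= y <= 1 -> f y != 0.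
  move/subspace_continuousP : cf => /(_ x).
  rewrite /= in_itv/= => /(_ x01) /cvgrPdist_lt /(_ `|f x|).
  rewrite normr_gt0 => /(_ fx0) /nbhs_ballP[e /= e0 he]; exists e => // y xy y01.
  have := he y xy; rewrite /= in_itv/= => /(_ y01) h; apply/eqP => fy0.
  by move: h; rewrite /from_subspace fy0 subr0 ltxx.
(* An interval of [0, 1] around x, one-sided if x is an endpoint. *)
pose p := Num.max 0 (x - e); pose q := Num.min 1 (x + e).
have pq : p < q.
  by rewrite /p /q lt_min !gt_max; apply/and3P; split; [apply/andP; split|..]; lra.
have sub : `]p, q[%classic `<=` N.
  move=> z; rewrite /= in_itv/= /p /q gt_max lt_min => /andP[/andP[z0 xz] /andP[z1 zx]].
  apply: fN => /=; apply/not_implyP; rewrite I01E z0 z1; split => //; apply/eqP.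
  by apply: he; [rewrite ltr_distlC; apply/andP; split; lra|rewrite !ltW].
have : (leb `]p, q[%classic <= leb N)%E.
  by apply: le_measure => //; rewrite inE//; exact: measurable_itv.
rewrite N0 lebesgue_measure_itv/= lte_fin pq -EFinD lee_fin leNgt subr_gt0 pq.
by [].
Qed.

Lemma bump_int_gt0 a b c : 0 < a -> a < b -> b < 1 -> 0 < c ->
  0 < \int[leb]_(x in I01 R) bump a b c x.
Proof.
move=> a0 ab b1 c0; rewrite lt_neqAle eq_sym; apply/andP; split; last first.
  by apply: Rintegral_ge0 => x _; exact: bump_ge0.
have bb := bdd_bump ab c0.
apply/eqP => /(int01_eq0 _ (bdd_L1 bb)) => z0.
have {}z0 : ae_zero (bump a b c) by apply: z0; apply: aeW => x _; exact: bump_ge0.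
have cb : continuous (bump a b c).
  by apply: smooth_cont => n x; exact: (@derivable_flatpoly R c 1 (hump a b) 0%N c0 n x).
have m01 : 0 <= (a + b) / 2 <= 1 by apply/andP; split; lra.
have := ae_zero_cont (continuous_subspaceT cb) z0 m01.
rewrite bumpE//; case: ifP; last by move=> /negP[]; apply/andP; split; lra.
by move=> _ /eqP; rewrite gt_eqF// expR_gt0.
Qed.

(** A continuous function orthogonal to all derivatives of test functions is
    constant. Fixing one bump psi, every other bump chi differs from a multiple
    of psi by a function of integral zero, hence by the derivative of a test
    function; so f minus its psi-weighted mean is orthogonal to all bumps. *)
Lemma du_bois_reymond f : {within `[0, 1]%classic, continuous f} ->
  (forall F, test_function F -> \int[leb]_(x in I01 R) (f x * derive1 F x) = 0) ->
  exists K, forall x, 0 <= x <= 1 -> f x = K.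
Proof.
move=> cf hf; pose psi : R -> R := bump 3^-1 2^-1 1.
have p0 : 0 < \int[leb]_(x in I01 R) psi x by apply: bump_int_gt0; lra.
have bf := bdd_cont01 cf; have Lf := bdd_L1 bf.
have bpsi : bdd psi by apply: bdd_bump; lra.
have spsi : smooth psi.
  by move=> n x; exact: (@derivable_flatpoly R 1 1 (hump 3^-1 2^-1) 0%N ltr01 n x).
pose K := (\int[leb]_(x in I01 R) (f x * psi x)) / \int[leb]_(x in I01 R) psi x.
exists K => x x01; apply/eqP; rewrite -subr_eq0; apply/eqP.
apply: (@ae_zero_cont (fun x => f x - K)) => //.
  by move=> y; apply: cvgB; [exact: cf|exact: cvg_cst].
apply: ae_zero_flcv; first by apply: L1B => //; exact/bdd_L1/bdd_cst.
move=> a b c a0 ab b1 c0; pose chi : R -> R := bump a b c.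
have bchi : bdd chi by exact: bdd_bump.
have schi : smooth chi.
  by move=> n y; exact: (@derivable_flatpoly R c 1 (hump a b) 0%N c0 n y).
pose k := (\int[leb]_(x in I01 R) chi x) / \int[leb]_(x in I01 R) psi x.
have [F tF dF] : exists2 F, test_function F & derive1 F = (fun x => chi x - k * psi x).
  apply: (@primitive_test _ (Num.min a 3^-1) (Num.max b 2^-1)).
  - by rewrite lt_min a0; lra.
  - apply: (@le_lt_trans _ _ 3^-1); first by rewrite ge_min lexx orbT.
    by rewrite lt_max; apply/orP; right; lra.
  - by rewrite gt_max b1; lra.
  - exact: smooth_lin.
  - move=> y; rewrite gt_min lt_max; apply: contra_neqT => yab.
    rewrite /chi /psi !bumpE//; last by lra.
    case: ifP => [/andP[ay yb]|_]; first by move: yab; rewrite ay yb.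
    case: ifP => [/andP[ay yb]|_]; first by move: yab; rewrite ay yb !orbT.
    by rewrite mulr0 subr0.
  - rewrite int01B ?int01Z//; [|exact: bdd_L1..|exact/L1Z/bdd_L1].
    by rewrite /k divfK ?subrr// gt_eqF.
have := hf _ tF; rewrite dF => h.
have Lfchi : L1 (fun x => f x * chi x) by exact: bdd_L1 (bddM bf bchi).
have Lfpsi : L1 (fun x => f x * psi x) by exact: bdd_L1 (bddM bf bpsi).
rewrite (@eq_int01 _ _ (fun x => f x * (chi x - k * psi x) +
    (k * (f x * psi x) - K * chi x))); last by move=> y _; rewrite /chi; ring.
rewrite int01D ?h ?add0r ?int01B ?int01Z//.
- by rewrite /k /K; ring.
- exact: bdd_L1.
- exact: L1Z.
- by apply: L1Z; exact: bdd_L1.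
- apply: bdd_L1; apply: bddM => //; apply: bddD => //; apply: bddN.
  by apply: bddM => //; exact: bdd_cst.
- by apply: L1B; [exact: L1Z|apply: L1Z; exact: bdd_L1].
Qed.
End DuBoisReymond.

(** * Functions with vanishing boundary values as iterated primitives *)

Section Sobolev.
Context {R : realType}.
Local Notation leb := (@lebesgue_measure R).
Implicit Types (a b c x y : R) (f g u v w phi : R -> R).

Lemma smooth_test phi : test_function phi -> smooth phi.
Proof. by case. Qed.

Lemma test_eq0 phi x : test_function phi -> ~ I01 R x -> phi x = 0.
Proof.
move=> [_ _ sub] xI; apply: contra_notP xI => /eqP px.
by apply: sub; exact: subset_closure.
Qed.

(** A derivative vanishes on any open set where the function vanishes, so its
    support is not larger. *)
Lemma test_derive1 phi : test_function phi -> test_function (derive1 phi).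
Proof.
move=> [sphi cpt sub].
have cl : [set x | derive1 phi x != 0] `<=` closure [set x | phi x != 0].
  move=> x /=; apply: contra_neqP => xcl.
  have : (~` [set x | phi x != 0])° x by rewrite interiorC.
  rewrite /interior => near0; rewrite derive1E.
  rewrite (@near_eq_derive _ _ _ _ (cst 0 : R -> R)); first exact: derive_cst.
  by apply: filterS near0 => y /= /negP; rewrite negbK => /eqP.
have {}cl : closure [set x | derive1 phi x != 0] `<=` closure [set x | phi x != 0].
  rewrite [X in _ `<=` X](proj1 (closure_id _) (@closed_closure _ _)).
  exact: closureS.
split; last exact: subset_trans cl sub.
  by move=> n x; have := sphi n.+1 x; rewrite /derive1n iterSr.
by apply: subclosed_compact cl; [exact: closed_closure|exact: cpt].
Qed.

Lemma bdd_test phi : test_function phi -> bdd phi.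
Proof.
move=> /smooth_test /smooth_cont cphi; exact/bdd_cont01/continuous_subspaceT.
Qed.

Lemma test_J0_parts w phi : L1 w -> test_function phi ->
  \int[leb]_(x in I01 R) (J 0 w x * derive1 phi x) =
  - \int[leb]_(x in I01 R) (w x * phi x).
Proof.
move=> Lw tphi; apply: J0_parts => //.
- have sphi : smooth phi by exact: smooth_test.
  by move=> x; rewrite derive1E; apply: derivableP; exact: (sphi 0%N x).
- by apply: smooth_cont; apply: smooth_test; exact: test_derive1.
- by apply: test_eq0 tphi _; rewrite I01E ltxx andbF.
Qed.

Lemma J_cont n w : L1 w -> {within `[0, 1]%classic, continuous (J n w)}.
Proof.
move=> Lw; case: n => [|n]; first exact: J0_cont.
have := J0_cont (bdd_L1 (bdd_J n Lw)).
apply: subspace_eq_continuous => x; rewrite inE/= in_itv/= => /andP[x0 x1].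
exact: J0_J.
Qed.

Lemma J_eval1 n w : L1 w -> J n w 1 =
  (n`!%:R)^-1 * \int[leb]_(t in I01 R) ((1 - t) ^+ n * w t).
Proof.
move=> Lw; rewrite -int01Z.
  by apply: eq_int01 => t /andP[t0 t1]; rewrite /Jker t1 mul1r; ring.
apply: L1_bddM => //; apply: bdd_cont01; apply: continuous_subspaceT.
rewrite (_ : (fun t => _) = horner ((1 - 'X) ^+ n)); first exact: continuous_horner.
by apply/funext => t; rewrite horner_exp hornerD hornerN hornerX hornerC.
Qed.

(** The successive weak derivatives are honest primitives of each other: by
    integration by parts, v minus the primitive of w is orthogonal to all
    derivatives of test functions, and its constant value is 0 because both
    vanish at 0. *)
Lemma weak_derivS u v w j : {within `[0, 1]%classic, continuous v} -> L1 w ->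
  weak_deriv j u v -> weak_deriv j.+1 u w -> v 0 = 0 ->
  forall x, 0 <= x <= 1 -> v x = J 0 w x.
Proof.
move=> cv Lw uv uw v0; have bv := bdd_cont01 cv.
have bJ := bdd_J 0 Lw.
have cJ := J0_cont Lw.
have [||K hK] := @du_bois_reymond R (fun x => v x - J 0 w x).
  by move=> x; apply: cvgB; [exact: cv|exact: cJ].
  move=> phi tphi; have tphi' := test_derive1 tphi.
  have bphi' := bdd_test tphi'.
  rewrite (@eq_int01 _ _ (fun x => v x * derive1 phi x - J 0 w x * derive1 phi x)).
    rewrite int01B; [|exact: bdd_L1 (bddM bv bphi')|exact: bdd_L1 (bddM bJ bphi')].
    rewrite test_J0_parts// opprK.
    have := uw _ tphi; rewrite /derive1n iterSr => E1; have := uv _ tphi'.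
    have s0 : (-1) ^+ j != 0 :> R by rewrite expf_neq0// oppr_eq0 oner_eq0.
    by rewrite /derive1n E1 exprSr -mulrA => /(mulfI s0) <-; rewrite mulN1r addNr.
  by move=> x _; rewrite mulrBl.
move=> x x01; apply/eqP; rewrite -subr_eq0 hK//.
by rewrite -(hK 0) ?lexx ?ler01// v0 J_eval0 subr0.
Qed.

(** Descending from order k, the boundary conditions at 0 fix all constants of
    integration. *)
Lemma sobolev0_chain k u uk : sobolev0 k u -> L2 uk -> weak_deriv k u uk ->
  forall i, (i < k)%N -> exists v, [/\ {within `[0, 1]%classic, continuous v},
    weak_deriv (k - i.+1) u v, v 1 = 0 &
    forall x, 0 <= x <= 1 -> v x = J i uk x].
Proof.
move=> [_ hb] Luk wk; elim=> [|i IH] ik.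
  have k1 : (k - 1 < k)%N by rewrite ltn_subrL.
  have [v [cv wv v0 v1]] := hb _ k1.
  exists v; split=> // x x01.
  apply: (weak_derivS cv (L2_L1 Luk) wv) => //.
  by rewrite subn1 prednK.
have [v [cv wv v1 vE]] := IH (ltnW ik).
have k2 : (k - i.+2 < k)%N by rewrite ltn_subrL (leq_trans _ ik).
have [v' [cv' wv' v'0 v'1]] := hb _ k2.
exists v'; split=> // x x01.
have bv := bdd_cont01 cv.
rewrite (weak_derivS cv' (bdd_L1 bv) wv' _ v'0 x01); last by rewrite subnSK.
have /andP[x0 x1] := x01.
rewrite -J0_J//; last exact: L2_L1.
rewrite !J0E; apply: eq_int01 => t /andP[t0 t1]; rewrite vE//.
by rewrite !ltW.
Qed.

(** The k-th weak derivative uk determines u: the conditions at 0 make u its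
    k-fold primitive, and the conditions at 1 say that uk is orthogonal to all
    polynomials of degree less than k. *)
Theorem sobolev0_repr k u uk : (0 < k)%N -> sobolev0 k u -> L2 uk ->
  weak_deriv k u uk ->
  {ae leb, forall x, I01 R x -> u x = J k.-1 uk x} /\
  forall m, (m < k)%N -> \int[leb]_(t in I01 R) ((1 - t) ^+ m * uk t) = 0.
Proof.
move=> k0 su Luk wk; have ch := sobolev0_chain su Luk wk.
have Lu : L1 u by have [[L2u _] _] := su; exact: L2_L1.
have L1uk := L2_L1 Luk.
split; last first.
  move=> m /ch[v [_ _ v1 vE]]; have := vE 1; rewrite v1 ler01 lexx => /(_ isT)/esym.
  rewrite J_eval1// => /eqP; rewrite mulf_eq0 invr_eq0 (negbTE (fact_unit _)).
  by move=> /eqP.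
have k1 : (k.-1 < k)%N by rewrite prednK.
have [v [cv wv _ vE]] := ch _ k1.
rewrite prednK// subnn in wv.
have Lv := bdd_L1 (bdd_cont01 cv).
have : ae_zero (fun x => u x - v x).
  apply: ae_zero_flcv; first exact: L1B.
  move=> a b c a0 ab b1 c0; have tb := test_bump c0 a0 ab b1.
  have bb := bdd_test tb.
  rewrite (@eq_int01 _ _ (fun x => bump a b c x * u x - bump a b c x * v x)).
    rewrite int01B; [|exact: L1_bddM..].
    have := wv _ tb; rewrite expr0 mul1r.
    under eq_Rintegral do rewrite derive1n0 mulrC.
    under [in RHS]eq_Rintegral do rewrite mulrC.
    by move=> ->; rewrite subrr.
  by move=> x _; rewrite mulrC mulrBr.
apply: ae_imp => x h xI; apply/eqP; rewrite -subr_eq0 -vE.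
  by apply/eqP; exact: h.
by move: xI; rewrite I01E => /andP[x0 x1]; rewrite !ltW.
Qed.

(** Converse of the previous theorem. The intermediate derivatives are the
    lower-order primitives, continuous as soon as w is integrable. *)
Theorem sobolev0_J k w : (0 < k)%N -> L2 w ->
  (forall m, (m < k)%N -> \int[leb]_(t in I01 R) ((1 - t) ^+ m * w t) = 0) ->
  sobolev0 k (J k.-1 w) /\ weak_deriv k (J k.-1 w) w.
Proof.
move=> k0 L2w hw; have Lw := L2_L1 L2w.
pose V j := if (j < k)%N then J (k - j.+1) w else w.
have V0 : V 0%N = J k.-1 w by rewrite /V k0 subn1.
have LV j : L2 (V j) by rewrite /V; case: ifP => // _; exact/L2_bdd/bdd_J.
have VS j x : (j < k)%N -> 0 < x < 1 -> V j x = J 0 (V j.+1) x.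
  move=> jk /andP[x0 x1]; rewrite {1}/V jk /V; case: ifP => jk'.
    by rewrite J0_J ?ltW// subnSK.
  have -> : (k - j.+1 = 0)%N by apply/eqP; rewrite subn_eq0 leqNgt jk'.
  by [].
have wV j : (j <= k)%N -> weak_deriv j (J k.-1 w) (V j).
  elim: j => [|j IH] jk phi tphi.
    by rewrite expr0 mul1r V0; under eq_Rintegral do rewrite derive1n0.
  have := IH (ltnW jk) _ (test_derive1 tphi).
  rewrite /derive1n -iterSr => ->; rewrite exprS -mulrA mulrCA; congr (_ * _).
  rewrite mulN1r -test_J0_parts//; last exact: L2_L1.
  by apply: eq_int01 => x x01; rewrite VS.
have wk : weak_deriv k (J k.-1 w) w.
  by have := wV k (leqnn k); rewrite /V ltnn.
split=> //; split.
  split; first by rewrite -V0.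
  by move=> j jk; exists (V j) => //; exact: wV.
move=> j jk; exists (V j); split; [|exact/wV/ltnW|..]; rewrite /V jk.
- exact: J_cont.
- exact: J_eval0.
- rewrite J_eval1// hw ?mulr0//.
  by rewrite ltn_subrL.
Qed.
End Sobolev.

(** * Boggio's formula and the matrix A *)

Section GreenPolynomial.
Context {R : realType}.
Local Notation leb := (@lebesgue_measure R).
Implicit Types (a b c x y z : R) (p q s : {poly R}).

(** Identities between polynomials may be checked on values, since the field is
    infinite: the natural numbers give too many roots. *)
Lemma poly_ext p q : (forall x, p.[x] = q.[x]) -> p = q.
Proof.
move=> pq; apply/eqP; rewrite -subr_eq0; apply/eqP.
pose rs : seq R := [seq i%:R | i <- iota 0 (size (p - q))].
apply: (@roots_geq_poly_eq0 _ _ rs).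
- by apply/allP => x _; rewrite rootE hornerD hornerN pq subrr.
- by rewrite map_inj_uniq ?iota_uniq// => i j /eqP; rewrite eqr_nat => /eqP.
- by rewrite size_map size_iota.
Qed.

(** Beta integrals. Integrating by parts lowers m and raises i, which yields a
    polynomial primitive by induction. *)
Lemma convol_primitive m i a b : exists F : {poly R},
  [/\ F^`() = ((m`!)%:R)^-1 *: (b%:P - 'X) ^+ m * dpow i a, F.[a] = 0 &
      F.[b] = (b - a) ^+ (m + i).+1 / ((m + i).+1`!)%:R].
Proof.
elim: m i => [|m IH] i.
  exists (dpow i.+1 a); rewrite deriv_dpow !dpowE subrr expr0n/= mul0r.
  by rewrite expr0 invr1 scale1r mul1r add0n.
have [F [dF Fa Fb]] := IH i.+1.
exists (((m.+1`!)%:R)^-1 *: (b%:P - 'X) ^+ m.+1 * dpow i.+1 a + F).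
have dE : (((m.+1`!)%:R)^-1 *: (b%:P - 'X) ^+ m.+1)^`() =
    - (((m`!)%:R)^-1 *: (b%:P - 'X) ^+ m).
  rewrite derivZ deriv_exp derivB derivX derivC sub0r mulN1r /=.
  rewrite mulNrn scalerN -scalerMnr scalerMnl; congr (- (_ *: _)).
  by rewrite -mulr_natr factS natrM invfM mulrAC mulVf ?mul1r// pnatr_eq0.
split.
- rewrite derivD derivM dE deriv_dpow dF; ring.
- by rewrite hornerD hornerM dpowE subrr expr0n/= mul0r mulr0 add0r.
- have z0 : (((m.+1`!)%:R)^-1 *: (b%:P - 'X) ^+ m.+1).[b] = 0.
    by rewrite hornerZ horner_exp hornerD hornerN hornerC hornerX subrr expr0n/= mulr0.
  by rewrite hornerD hornerM Fb z0 mul0r add0r addnS.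
Qed.

Lemma int01_convol m i a b : 0 <= a -> a <= b -> b <= 1 ->
  \int[leb]_(x in I01 R) ((a < x)%R%:R * (x < b)%R%:R *
     ((b - x) ^+ m / (m`!)%:R * ((x - a) ^+ i / (i`!)%:R))) =
  (b - a) ^+ (m + i).+1 / ((m + i).+1`!)%:R.
Proof.
move=> a0 ab b1; have [F [dF Fa Fb]] := convol_primitive m i a b.
rewrite -Fb -[RHS]subr0 -Fa -int01_poly//; apply: eq_int01 => x _.
by rewrite dF hornerM hornerZ dpowE horner_exp hornerD hornerN hornerC hornerX; ring.
Qed.

(** The primitive, vanishing at 0, of T ^ n (T + e) ^ n. *)
Definition beta_poly n e : {poly R} :=
  \sum_(i < n.+1) ('C(n, i)%:R / (n.+1 + i)%:R * e ^+ (n - i)) *: 'X^(n.+1 + i).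

Lemma deriv_beta_poly n e : (beta_poly n e)^`() = 'X^n * ('X + e%:P) ^+ n.
Proof.
apply: poly_ext => x; rewrite /beta_poly raddf_sum horner_sum hornerM.
rewrite hornerXn horner_exp hornerD hornerX hornerC addrC exprDn mulr_sumr.
apply: eq_bigr => i _ /=; rewrite derivZ derivXn addSn/= hornerZ hornerMn hornerXn exprD.
have nz : (n + i).+1%:R != 0 :> R by rewrite pnatr_eq0.
rewrite -[_ *+ (n + i).+1]mulr_natr -[_ *+ 'C(n, i)]mulr_natr.
by set N : R := _.+1%:R in nz *; field.
Qed.

Lemma beta_poly0 n e : (beta_poly n e).[0] = 0.
Proof.
by rewrite /beta_poly horner_sum big1// => i _; rewrite hornerZ hornerXn expr0n addSn mulr0.
Qed.

(** Homogeneity of degree 2 n + 1. *)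
Lemma beta_poly_scale n d : (beta_poly n (- d)).[d] = d ^+ (2 * n).+1 * (beta_poly n (- 1)).[1].
Proof.
rewrite /beta_poly !horner_sum mulr_sumr; apply: eq_bigr => i _.
rewrite !hornerZ !hornerXn expr1n mulr1 -(mulN1r d) exprMn.
have -> : d ^+ (2 * n).+1 = d ^+ (n - i) * d ^+ (n.+1 + i).
  rewrite -exprD; congr (_ ^+ _); have := ltn_ord i; rewrite ltnS => ile.
  by rewrite addnCA subnK// addSn mul2n -addnn.
ring.
Qed.

Lemma beta_poly1 n : (beta_poly n (- 1)).[1] =
  (-1) ^+ n * ((n`!)%:R ^+ 2 / ((2 * n).+1`!)%:R).
Proof.
have := int01_poly (beta_poly n (- 1)) (lexx 0) ler01 (lexx 1).
rewrite beta_poly0 subr0 => <-.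
have := int01_convol n n (lexx 0) ler01 (lexx 1).
rewrite subr0 expr1n mul1r addnn -mul2n => <-.
have f0 := fact_unit (R := R) n; rewrite mulrA -int01Z; last first.
  apply: L1_bddM; first exact: bdd_step2.
  pose p : {poly R} := ((n`!)%:R)^-1 *: (1 - 'X) ^+ n * dpow n 0.
  rewrite (_ : (fun x => _) = horner p).
    apply: bdd_L1; apply: bdd_cont01; apply: continuous_subspaceT.
    exact: continuous_horner.
  apply/funext => x; rewrite hornerM hornerZ horner_exp hornerD hornerN hornerX hornerC.
  by rewrite dpowE; ring.
apply: eq_int01 => x _; rewrite deriv_beta_poly hornerM hornerXn horner_exp.
rewrite hornerD hornerX hornerC.
have -> : (x - 1) ^+ n = (-1) ^+ n * (1 - x) ^+ n by rewrite -exprMn mulN1r opprB.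
by rewrite subr0; field; exact: f0.
Qed.

Lemma is_derive0_horner p : p^`() = 0 -> forall x y, p.[x] = p.[y].
Proof.
move=> dp x y; apply: (@is_derive_0_is_cst _ (horner p)) => z.
by have := is_derive_poly p z; rewrite dp horner0.
Qed.

(** Translating by d exchanges the two factors of T ^ n (T - d) ^ n, so the
    two terms on the left have the same derivative in T; their difference is
    computed at T = d. *)
Lemma beta_poly_reflect n T d : (beta_poly n (- d)).[T] - (beta_poly n d).[T - d] =
  (-1) ^+ n * ((n`!)%:R ^+ 2 / ((2 * n).+1`!)%:R) * d ^+ (2 * n).+1.
Proof.
pose D := beta_poly n (- d) - (beta_poly n d \Po ('X - d%:P)).
have dD : D^`() = 0.
  rewrite /D derivB deriv_comp !deriv_beta_poly derivB derivX derivC subr0 mulr1.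
  by rewrite rmorphM !rmorphXn/= rmorphD/= comp_polyX comp_polyC subrK polyCN mulrC subrr.
have DE x : D.[x] = (beta_poly n (- d)).[x] - (beta_poly n d).[x - d].
  by rewrite /D hornerD hornerN horner_comp !hornerE.
rewrite -DE (is_derive0_horner dD T d) DE subrr beta_poly0 subr0 beta_poly_scale beta_poly1.
by rewrite mulrC.
Qed.

(** Boggio's formula in dimension one. With k = n + 1, the Green function of
    (- 1) ^ k d ^ 2k / dx ^ 2k with Dirichlet conditions is, for x <= z, the
    integral of t ^ n (t + z - x) ^ n / n! ^ 2 for t from 0 to (1 - z) x.
    Expanding the second factor makes this x ^ k times the polynomial
    green_left n z; green_right plays the same role for z <= x, with the factor
    (1 - x) ^ k. *)
Definition green_left n z : {poly R} := ((n`!)%:R ^- 2) *: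
  \sum_(i < n.+1) ('C(n, i)%:R / (n.+1 + i)%:R * (1 - z) ^+ (n.+1 + i)) *:
     ((z%:P - 'X) ^+ (n - i) * 'X^i).

Definition green_right n z : {poly R} := ((n`!)%:R ^- 2) *:
  \sum_(i < n.+1) ('C(n, i)%:R / (n.+1 + i)%:R * z ^+ (n.+1 + i)) *:
     (('X - z%:P) ^+ (n - i) * (1 - 'X) ^+ i).

Lemma green_leftE n z x : x ^+ n.+1 * (green_left n z).[x] =
  ((n`!)%:R ^- 2) * (beta_poly n (- (x - z))).[(1 - z) * x].
Proof.
rewrite /green_left /beta_poly hornerZ !horner_sum mulrCA mulr_sumr; congr (_ * _).
apply: eq_bigr => i _; rewrite !(hornerZ, hornerM, horner_exp, hornerD, hornerN, hornerC, hornerX).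
by rewrite opprB exprMn !exprD; ring.
Qed.

Lemma green_rightE n z x : (1 - x) ^+ n.+1 * (green_right n z).[x] =
  ((n`!)%:R ^- 2) * (beta_poly n (x - z)).[z * (1 - x)].
Proof.
rewrite /green_right /beta_poly hornerZ !horner_sum mulrCA mulr_sumr; congr (_ * _).
apply: eq_bigr => i _; rewrite !(hornerZ, hornerM, horner_exp, hornerD, hornerN, hornerC, hornerX).
by rewrite exprMn !exprD; ring.
Qed.

(** The two branches differ exactly by the fundamental solution
    (x - z) ^ (2 k - 1) / (2 k - 1)!, up to the sign; they vanish to order k at
    0 and at 1 respectively, which characterizes the Green function. *)
Lemma green_jump n z : 'X^(n.+1) * green_left n z + (-1) ^+ n.+1 *: dpow (2 * n).+1 z =
  (1 - 'X) ^+ n.+1 * green_right n z.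
Proof.
apply: poly_ext => x.
rewrite hornerD hornerZ dpowE [in LHS]hornerM hornerXn green_leftE.
rewrite [in RHS]hornerM horner_exp hornerD hornerN hornerX hornerC green_rightE.
have := beta_poly_reflect n ((1 - z) * x) (x - z).
have -> : (1 - z) * x - (x - z) = z * (1 - x) by ring.
move=> /eqP; rewrite subr_eq => /eqP ->.
have := fact_unit (R := R) n; have := fact_unit (R := R) (2 * n).+1.
set f := (n`!)%:R; set g := (_`!)%:R => g0 f0.
rewrite (_ : (-1) ^+ n.+1 = - (-1) ^+ n); last by rewrite exprS mulN1r.
move: ((-1) ^+ n) ((x - z) ^+ _) (beta_poly _ _).[_] => A B C.
field.
by rewrite g0 f0.
Qed.

Lemma size_green_left n z : (size (green_left n z) <= n.+1)%N.
Proof.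
apply: leq_trans (size_scale_leq _ _) _; apply: (leq_trans (size_sum _ _ _)).
apply/bigmax_leqP => i _; apply: leq_trans (size_scale_leq _ _) _.
apply: leq_trans (size_polyMleq _ _) _.
rewrite size_polyXn addnS /=.
have := size_exp_leq (z%:P - 'X : {poly R}) (n - i).
have -> : size (z%:P - 'X : {poly R}) = 2%N.
  by rewrite -opprB size_polyN size_XsubC.
rewrite mul1n => h; apply: leq_trans (leq_add h (leqnn i)) _.
by rewrite addSn subnK// -ltnS ltn_ord.
Qed.

(** All terms of Boggio's formula are nonnegative for x <= z, and the last one,
    which contains no power of z - x, is positive. *)
Lemma green_left_gt0 n z x : 0 < x -> x <= z -> z < 1 -> 0 < (green_left n z).[x].
Proof.
move=> x0 xz z1; rewrite /green_left hornerZ; apply: mulr_gt0.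
  by rewrite invr_gt0 exprn_gt0// ltr0n fact_gt0.
have z0 : 0 <= 1 - z by rewrite subr_ge0 ltW.
have zx0 : 0 <= z - x by rewrite subr_ge0.
have termE (i : 'I_n.+1) : (('C(n, i)%:R / (n.+1 + i)%:R * (1 - z) ^+ (n.+1 + i)) *:
    ((z%:P - 'X) ^+ (n - i) * 'X^i)).[x] =
    'C(n, i)%:R / (n.+1 + i)%:R * (1 - z) ^+ (n.+1 + i) * ((z - x) ^+ (n - i) * x ^+ i).
  by rewrite !(hornerZ, hornerM, horner_exp, hornerD, hornerN, hornerC, hornerX).
rewrite horner_sum (bigD1 ord_max)//= ltr_wpDr//.
  apply: sumr_ge0 => i _; rewrite termE; apply: mulr_ge0; apply: mulr_ge0.
  - exact: divr_ge0.
  - exact: exprn_ge0.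
  - exact: exprn_ge0.
  - by apply: exprn_ge0; exact: ltW.
rewrite (termE ord_max) /= subnn expr0 mul1r binn; apply: mulr_gt0; last exact: exprn_gt0.
by apply: mulr_gt0; [exact: divr_gt0|apply: exprn_gt0; rewrite subr_gt0].
Qed.

(** Coordinates of the left branch in the divided powers of degree
    2 k - 1 - j; the same numbers are the coordinates of its k-th derivative in
    the divided powers of degree k - 1 - j. *)
Definition green_coef n z (j : nat) : R := ((2 * n).+1 - j)`!%:R * (green_left n z)`_(n - j).

Lemma green_left_dpow n z : 'X^(n.+1) * green_left n z =
  \sum_(j < n.+1) green_coef n z j *: dpow ((2 * n).+1 - j) 0.
Proof.
have -> : green_left n z = \sum_(i < n.+1) (green_left n z)`_i *: 'X^i.
  rewrite -poly_def; apply/polyP => i; rewrite coef_poly; case: ltnP => // h.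
  by rewrite nth_default// (leq_trans (size_green_left n z)).
rewrite mulr_sumr (reindex_inj rev_ord_inj)/=; apply: eq_bigr => j _.
rewrite subSS -scalerAr -exprD /green_coef /dpow polyC0 subr0 scalerA mulrAC.
rewrite mulfV ?fact_unit// mul1r; congr (_ *: 'X^_).
have := ltn_ord j; rewrite ltnS => jn.
by rewrite addSn addnBA// addnn -mul2n subSn// (leq_trans jn)// mul2n -addnn leq_addr.
Qed.

Lemma derivn_dpow i m t : (i <= m)%N -> (dpow m t : {poly R})^`(i) = dpow (m - i) t.
Proof.
elim: i => [|i IH] im; first by rewrite derivn0 subn0.
by rewrite derivnS (IH (ltnW im)) -(subnSK im) deriv_dpow.
Qed.

Lemma derivn_vanish k s i : (i < k)%N -> ((1 - 'X) ^+ k * s)^`(i).[1] = 0.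
Proof.
move=> ik; have [q ->] : exists q, ((1 - 'X) ^+ k * s)^`(i) = (1 - 'X) ^+ (k - i) * q.
  elim: i ik => [|i IH] ik; first by exists s; rewrite derivn0 subn0.
  have [q E] := IH (ltnW ik); rewrite derivnS E -(subnSK (ltnW ik)).
  exists (((k - i.+1).+1)%:R * (1 - 'X)^`() * q + (1 - 'X) * q^`()).
  by rewrite derivM deriv_exp /= -mulr_natr exprS; ring.
rewrite hornerM horner_exp hornerD hornerN hornerX hornerC subrr expr0n.
by rewrite subn_eq0 leqNgt ik mul0r.
Qed.

(** Evaluate at 1 the derivative of order n - m of the jump identity: the right
    branch contributes nothing, because it vanishes there to order n + 1. *)
Lemma green_coef_moment n z (m : 'I_n.+1) :
  \sum_(j < n.+1) green_coef n z j / ((n.+1 + m - j)`!)%:R =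
  (-1) ^+ n * ((1 - z) ^+ (n.+1 + m) / ((n.+1 + m)`!)%:R).
Proof.
have mn : (m <= n)%N by rewrite -ltnS.
have km : (n - m < n.+1)%N by rewrite ltnS leq_subr.
have idx j : (j <= n)%N -> ((2 * n).+1 - j - (n - m) = n.+1 + m - j)%N.
  move=> jn; rewrite subnAC; congr (_ - _)%N.
  by rewrite mul2n -addnn -addSn subnBA// -addnA (addnC n m) addnA addnK.
have idx_le j : (j <= n)%N -> (n - m <= (2 * n).+1 - j)%N.
  move=> jn; rewrite (leq_trans (leq_subr m n))// leq_subRL; last first.
    by rewrite (leq_trans jn)// mul2n -addnn leqW// leq_addr.
  by rewrite mul2n -addnn leqW// leq_add2r.
have sumE : (\sum_(j < n.+1) green_coef n z j *: dpow ((2 * n).+1 - j) 0)^`(n - m).[1] =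
    \sum_(j < n.+1) green_coef n z j / ((n.+1 + m - j)`!)%:R.
  rewrite raddf_sum/= horner_sum; apply: eq_bigr => j _.
  have jn : (j <= n)%N by rewrite -ltnS.
  by rewrite derivnZ hornerZ (derivn_dpow _ (idx_le _ jn)) idx// dpowE subr0 expr1n mul1r.
have := congr1 (fun p => p^`(n - m).[1]) (green_jump n z).
rewrite /= (derivn_vanish _ km) green_left_dpow derivnD hornerD sumE derivnZ hornerZ.
have := idx_le 0%N (leq0n n); rewrite subn0 => le0.
have := idx 0%N (leq0n n); rewrite !subn0 => idx0.
rewrite (derivn_dpow _ le0) idx0 dpowE => /eqP; rewrite addr_eq0 => /eqP ->.
by rewrite exprS mulN1r mulNr opprK.
Qed.

Definition jump_col n z : 'cV[R]_n.+1 := \col_m ((-1) ^+ n * (1 - z) ^+ (n.+1 + m)).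

Lemma Amx_green_coef n z : Amx R n.+1 *m (\col_j green_coef n z j) = jump_col n z.
Proof.
apply/matrixP => m o; rewrite !mxE.
have -> : (-1) ^+ n * (1 - z) ^+ (n.+1 + m) = ((n.+1 + m)`!)%:R *
    ((-1) ^+ n * ((1 - z) ^+ (n.+1 + m) / ((n.+1 + m)`!)%:R)).
  by field; exact: fact_unit.
rewrite -green_coef_moment mulr_sumr; apply: eq_bigr => j _; rewrite !mxE.
by rewrite -mulrA [_^-1 * _]mulrC.
Qed.

(** A row r killed by A is killed by all the columns jump_col n z, which lie in
    the image of A; this says that the polynomial with coefficients r, shifted
    by k, vanishes at every point. *)
Lemma Amx_unit n : Amx R n.+1 \in unitmx.
Proof.
rewrite -row_free_unit; apply: inj_row_free => r rA.
pose P : {poly R} := \sum_(m < n.+1) r 0 m *: 'X^(n.+1 + m).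
have P0 : P = 0.
  apply: poly_ext => x; rewrite horner0.
  have /(congr1 (fun M : 'M[R]_1 => M 0 0)) : r *m jump_col n (1 - x) = 0.
    by rewrite -Amx_green_coef mulmxA rA mul0mx.
  rewrite !mxE => /(congr1 (fun e => (-1) ^+ n * e)); rewrite mulr0 => <-.
  rewrite /P horner_sum mulr_sumr; apply: eq_bigr => m _.
  rewrite hornerZ hornerXn mxE opprB addrCA subrr addr0.
  by rewrite mulrCA signrMK.
apply/rowP => m; rewrite mxE.
have := congr1 (fun p : {poly R} => p`_(n.+1 + m)) P0; rewrite coef0 /P coef_sum.
rewrite (bigD1 m)//= big1 ?addr0; first by rewrite coefZ coefXn eqxx mulr1.
by move=> i im; rewrite coefZ coefXn eqn_add2l val_eqE eq_sym (negbTE im) mulr0.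
Qed.

(** The coefficients of Boggio's formula are those produced by the inverse of A:
    this is where the matrix of the statement meets positivity. *)
Lemma green_coefE n z (j : 'I_n.+1) : green_coef n z j =
  \sum_(m < n.+1) invmx (Amx R n.+1) j m * ((-1) ^+ n * (1 - z) ^+ (n.+1 + m)).
Proof.
have := congr1 (mulmx (invmx (Amx R n.+1))) (Amx_green_coef n z).
rewrite mulKmx ?Amx_unit// => /matrixP /(_ j 0); rewrite !mxE => ->.
by apply: eq_bigr => m _; rewrite !mxE.
Qed.
End GreenPolynomial.

(** * Positivity of the Green function *)

Section GreenKernel.
Context {R : realType} (n : nat).
Local Notation leb := (@lebesgue_measure R).
Implicit Types (a b c x y z t : R) (p q s : {poly R}) (f g w rho : R -> R).

Definition dgreen_poly z : {poly R} := \sum_(j < n.+1) green_coef n z j *: dpow (n - j) 0.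

(** The k-th derivative in x of the Green function with pole y. It is the
    component orthogonal to the polynomials of degree less than k of
    (- 1) ^ k (x - y)_+ ^ (k - 1) / (k - 1)!. *)
Definition dgreen x y : R := (dgreen_poly y).[x] + (-1) ^+ n.+1 * Jker n x y.

Lemma bkernel_sum (I : Type) (s : seq I) (F : I -> R -> R -> R) :
  (forall i, bkernel (F i)) -> bkernel (fun x y => \sum_(i <- s) F i x y).
Proof.
move=> bF; elim: s => [|i s IH].
  by under eq_fun do under eq_fun do rewrite big_nil; exact: bkernel_cst.
by under eq_fun do under eq_fun do rewrite big_cons; exact: bkernelD.
Qed.

Lemma dgreen_polyE x y : (dgreen_poly y).[x] = \sum_(j < n.+1) x ^+ (n - j) / ((n - j)`!)%:R *
  \sum_(m < n.+1) invmx (Amx R n.+1) j m * ((-1) ^+ n * (1 - y) ^+ (n.+1 + m)).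
Proof.
rewrite /dgreen_poly horner_sum; apply: eq_bigr => j _.
by rewrite hornerZ dpowE subr0 mulrC green_coefE.
Qed.

Lemma bkernel_dgreen : bkernel dgreen.
Proof.
apply: bkernelD; last by apply: bkernelM; [exact: bkernel_cst|exact: bkernel_Jker].
under eq_fun do under eq_fun do rewrite dgreen_polyE.
apply: bkernel_sum => j; apply: bkernelM.
  by apply: bkernelM; [apply: bkernelX; exact: bkernel_fst|exact: bkernel_cst].
apply: bkernel_sum => m; apply: bkernelM; first exact: bkernel_cst.
apply: bkernelM; first exact: bkernel_cst.
by apply: bkernelX; apply: bkernelB; [exact: bkernel_cst|exact: bkernel_snd].
Qed.

(** Orthogonality to all polynomials of degree less than k, tested on the powers
    of 1 - t because these come from the boundary conditions at 1. *)
Definition moments0 w := forall m, (m < n.+1)%N ->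
  \int[leb]_(t in I01 R) ((1 - t) ^+ m * w t) = 0.

Lemma bdd_horner p : bdd (horner p).
Proof. by apply/bdd_cont01; apply: continuous_subspaceT; exact: continuous_horner. Qed.

Lemma L1_horner p w : L1 w -> L1 (fun t => p.[t] * w t).
Proof. by move=> Lw; apply: L1_bddM => //; exact: bdd_horner. Qed.

Lemma horner_omX m t : ((1 - 'X) ^+ m : {poly R}).[t] = (1 - t) ^+ m.
Proof. by rewrite !(horner_exp, hornerD, hornerN, hornerX, hornerC). Qed.

Lemma bdd_omX m : bdd (fun t => (1 - t) ^+ m).
Proof.
rewrite (_ : (fun t => _) = horner ((1 - 'X) ^+ m)); first exact: bdd_horner.
by apply/funext => t; rewrite horner_omX.
Qed.

(** Powers of 1 - t span: expand p composed with 1 - X. *)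
Lemma moments0_poly w p : L1 w -> moments0 w -> (size p <= n.+1)%N ->
  \int[leb]_(t in I01 R) (p.[t] * w t) = 0.
Proof.
move=> Lw ow sp; pose q := p \Po (1 - 'X).
have sz : (size q <= n.+1)%N.
  rewrite /q size_comp_poly2// -opprB size_polyN.
  exact: size_XsubC.
have pE t : p.[t] = \sum_(i < n.+1) q`_i * (1 - t) ^+ i.
  rewrite -(horner_coef_wide _ sz) /q horner_comp !(hornerD, hornerN, hornerX, hornerC).
  by rewrite opprB addrCA subrr addr0.
have Lt i : L1 (fun t => q`_i * ((1 - t) ^+ i * w t)).
  by apply: L1Z; apply: L1_bddM => //; exact: bdd_omX.
rewrite (@eq_int01 _ _ (fun t => \sum_(i < n.+1) q`_i * ((1 - t) ^+ i * w t))).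
  have [_ ->] := int01_sum (index_enum _) (fun i : 'I_n.+1 => Lt i).
  apply: big1 => i _; rewrite int01Z ?ow ?mulr0//.
  by apply: L1_bddM => //; exact: bdd_omX.
by move=> t _; rewrite pE mulr_suml; apply: eq_bigr => i _; rewrite mulrA.
Qed.

Lemma size_dgreen_poly z : (size (dgreen_poly z) <= n.+1)%N.
Proof.
apply: (leq_trans (size_sum _ _ _)); apply/bigmax_leqP => j _.
rewrite /dpow; do 2 apply: leq_trans (size_scale_leq _ _) _.
rewrite polyC0 subr0 size_polyXn ltnS; exact: leq_subr.
Qed.

(** The two open halves miss only the point y. *)
Lemma int01_split F y : L1 F ->
  \int[leb]_(t in I01 R) ((t < y)%R%:R * F t) +
  \int[leb]_(t in I01 R) ((y < t)%R%:R * F t) = \int[leb]_(t in I01 R) F t.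
Proof.
move=> LF.
have L1y := L1_bddM (bdd_stepl y) LF; have L2y := L1_bddM (bdd_stepr y) LF.
rewrite -int01D//; apply: ae_eq_int01.
- exact: L1_meas (L1D L1y L2y).
- exact: L1_meas.
exists [set y]; split; [exact: measurable_set1|exact: lebesgue_measure_set1|].
move=> t /= ht; apply: contrapT => /eqP ty; apply: ht => _.
by move: ty; case: ltgtP => // _ _; rewrite mul1r mul0r ?addr0 ?add0r.
Qed.

(** Cauchy's kernel and the transposed k-th derivative of the Green function
    differ by a polynomial of degree less than k in t, to which w is
    orthogonal. *)
Lemma J_dgreen w y : L1 w -> moments0 w -> I01 R y ->
  J n w y = \int[leb]_(t in I01 R) (dgreen t y * w t).
Proof.
move=> Lw ow yI; pose p : {poly R} := ((n`!)%:R)^-1 *: (y%:P - 'X) ^+ n.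
have pE t : p.[t] = (y - t) ^+ n / (n`!)%:R.
  by rewrite /p !(hornerZ, horner_exp, hornerD, hornerN, hornerX, hornerC) mulrC.
have sp : (size p <= n.+1)%N.
  apply: leq_trans (size_scale_leq _ _) _; apply: leq_trans (size_exp_leq _ _) _.
  by rewrite -opprB size_polyN size_XsubC /= mul1n.
have Lpw := L1_horner p Lw.
have := int01_split y Lpw; rewrite (moments0_poly Lw ow sp) => /eqP.
rewrite addr_eq0 => /eqP E.
have -> : J n w y = \int[leb]_(t in I01 R) ((t < y)%R%:R * (p.[t] * w t)).
  by apply: eq_int01 => t _; rewrite pE /Jker; ring.
rewrite {}E -mulN1r.
have LJ : L1 (fun t => Jker n t y * w t).
  by apply: L1_bddM => //; exact: bkernel_bdd1 (bkernel_Jker n) yI.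
rewrite (@eq_int01 _ (fun t => dgreen t y * w t)
  (fun t => (dgreen_poly y).[t] * w t + (-1) ^+ n.+1 * (Jker n t y * w t))); last first.
  by move=> t _; rewrite /dgreen; ring.
rewrite int01D; [|exact: L1_horner|exact: L1Z].
rewrite (moments0_poly Lw ow (size_dgreen_poly y)) add0r.
have -> : \int[leb]_(t in I01 R) ((y < t)%R%:R * (p.[t] * w t)) =
    (-1) ^+ n * \int[leb]_(t in I01 R) (Jker n t y * w t).
  rewrite -int01Z//; apply: eq_int01 => t _; rewrite pE /Jker.
  have -> : (y - t) ^+ n = (-1) ^+ n * (t - y) ^+ n by rewrite -exprMn mulN1r opprB.
  by ring.
by rewrite int01Z// exprS mulrA.
Qed.

Lemma L1_dgreen y : I01 R y -> L1 (dgreen ^~ y).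
Proof. by move=> yI; apply: bdd_L1; exact: bkernel_bdd1 bkernel_dgreen yI. Qed.

(** The polynomial part and the truncated power both contribute Beta integrals,
    which cancel by the moment identity for the coefficients. *)
Lemma moments0_dgreen y : I01 R y -> moments0 (dgreen ^~ y).
Proof.
move=> yI m mn; have y01 := yI; rewrite I01E in y01; have /andP[y0 y1] := y01.
pose M t : R := (1 - t) ^+ m / (m`!)%:R.
have bM : bdd M.
  by apply: bddM (bdd_cst _); exact: bdd_omX.
have LJ : L1 (fun t => M t * Jker n t y).
  by apply: L1_bddM => //; apply: bdd_L1; exact: bkernel_bdd1 (bkernel_Jker n) yI.
have Ldp j : L1 (fun t => green_coef n y j * (M t * (dpow (n - j) 0).[t])).
  by apply: L1Z; apply: L1_bddM => //; apply: bdd_L1; exact: bdd_horner.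
have [LS ES] := int01_sum (index_enum _) (fun j : 'I_n.+1 => Ldp j).
rewrite (@eq_int01 _ _ (fun t => (m`!)%:R * (\sum_(j < n.+1)
    green_coef n y j * (M t * (dpow (n - j) 0).[t]) + (-1) ^+ n.+1 * (M t * Jker n t y)))); last first.
  move=> t _; rewrite /dgreen /dgreen_poly horner_sum.
  rewrite [in RHS](eq_bigr (fun j : 'I_n.+1 => M t * (green_coef n y j *: dpow (n - j) 0).[t])); last first.
    by move=> j _; rewrite [in RHS]hornerZ mulrCA.
  rewrite -mulr_sumr [X in _ = _ * (_ + X)]mulrCA -mulrDr mulrA.
  by rewrite (_ : _%:R * M t = (1 - t) ^+ m)// /M mulrC divfK ?fact_unit.
rewrite int01Z; last by apply: L1D => //; exact: L1Z.
rewrite int01D//; last exact: L1Z.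
rewrite ES int01Z//.
have -> : \int[leb]_(t in I01 R) (M t * Jker n t y) =
    (1 - y) ^+ (n.+1 + m) / ((n.+1 + m)`!)%:R.
  have := int01_convol m n (ltW y0) (ltW y1) (lexx 1).
  rewrite addnC -addSn => <-; apply: eq_int01 => t /andP[_ t1].
  by rewrite t1 mulr1 /Jker /M mulrCA.
rewrite (eq_bigr (fun j : 'I_n.+1 => green_coef n y j / ((n.+1 + m - j)`!)%:R)); last first.
  move=> j _; have jn : (j <= n)%N by rewrite -ltnS.
  rewrite int01Z; last by apply: L1_bddM => //; apply: bdd_L1; exact: bdd_horner.
  congr (_ * _); have := int01_convol m (n - j) (lexx (0 : R)) ler01 (lexx 1).
  rewrite subr0 expr1n div1r addnC -addSn -subSn// addnBAC ?leqW// => <-.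
  by apply: eq_int01 => t /andP[t0 t1]; rewrite t0 t1 !mul1r dpowE.
rewrite (green_coef_moment _ (Ordinal mn)) /= exprS; ring.
Qed.

(** The Green function in its symmetric form, as a Gram matrix. *)
Definition green y z := \int[leb]_(t in I01 R) (dgreen t y * dgreen t z).

Lemma green_sym y z : green y z = green z y.
Proof. by apply: eq_int01 => t _; rewrite mulrC. Qed.

(** The Gram entry is the k-fold primitive of the k-th derivative of the Green
    function with pole z; left of z only its polynomial part is seen, and the
    k-fold primitive of that part is Boggio's polynomial. *)
Lemma green_poly y z : 0 < y -> y <= z -> z < 1 -> green y z = y ^+ n.+1 * (green_left n z).[y].
Proof.
move=> y0 yz z1.
have yI : I01 R y by rewrite I01E y0 (le_lt_trans yz).
have zI : I01 R z by rewrite I01E z1 (lt_le_trans y0).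
rewrite -[LHS]/(\int[leb]_(t in I01 R) (dgreen t y * (dgreen ^~ z) t)).
rewrite -J_dgreen//; [|exact: L1_dgreen|exact: moments0_dgreen].
have -> : y ^+ n.+1 * (green_left n z).[y] = ('X^(n.+1) * green_left n z).[y].
  by rewrite hornerM hornerXn.
rewrite green_left_dpow horner_sum.
have Ldp j : L1 (fun t => green_coef n z j * (Jker n y t * (dpow (n - j) 0).[t])).
  by apply: L1Z; apply: L1_kernel => //; [exact: bkernel_Jker|apply: bdd_L1; exact: bdd_horner].
have [LS ES] := int01_sum (index_enum _) (fun j : 'I_n.+1 => Ldp j).
transitivity (\int[leb]_(t in I01 R) (\sum_(j < n.+1)
    green_coef n z j * (Jker n y t * (dpow (n - j) 0).[t]))).
  apply: eq_int01 => t _; rewrite -(eq_bigr _ (fun j _ => mulrCA _ _ _)) -mulr_sumr.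
  rewrite /Jker; case: (ltP t y) => ty; last by rewrite !mul0r.
  rewrite /dgreen /Jker ltNge (ltW (lt_le_trans ty yz))/= mulr0n mul0r mulr0 addr0.
  by congr (_ * _); rewrite /dgreen_poly horner_sum; apply: eq_bigr => j _; rewrite hornerZ.
rewrite ES; apply: eq_bigr => j _.
have jn : (j <= n)%N by rewrite -ltnS.
rewrite int01Z; last first.
  by apply: L1_kernel => //; [exact: bkernel_Jker|apply: bdd_L1; exact: bdd_horner].
rewrite hornerZ dpowE; congr (_ * _).
have := int01_convol n (n - j) (lexx 0) (ltW y0) (ltW (le_lt_trans yz z1)).
rewrite subr0 -addSn addnBA// addSn addnn -mul2n => <-.
by apply: eq_int01 => t /andP[t0 t1]; rewrite t0 mul1r dpowE /Jker; ring.
Qed.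

Lemma green_gt0 y z : 0 < y < 1 -> 0 < z < 1 -> 0 < green y z.
Proof.
wlog yz : y z / y <= z => [hw y01 z01|].
  by have /orP[yz|zy] := le_total y z; [|rewrite green_sym]; exact: hw.
move=> /andP[y0 y1] /andP[z0 z1]; rewrite green_poly// mulr_gt0 ?exprn_gt0//.
exact: green_left_gt0.
Qed.

(** The k-th derivative of the solution u of (- 1) ^ k u ^ (2 k) = f with
    Dirichlet conditions, that is, the Riesz representative of integration
    against f for the scalar product of k-th derivatives. *)
Definition riesz f := kint dgreen f.

Lemma bdd_riesz f : L1 f -> bdd (riesz f).
Proof. by move=> Lf; apply: bdd_kint => //; exact: bkernel_dgreen. Qed.

Lemma moments0_riesz f : L1 f -> moments0 (riesz f).
Proof.
move=> Lf m mn.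
have LM : L1 (fun t => (1 - t) ^+ m).
  exact: bdd_L1 (bdd_omX m).
rewrite /riesz kint_fubini//; last exact: bkernel_dgreen.
rewrite (@eq_int01 _ _ (fun=> 0)) ?int01_cst// => y y01.
rewrite /kint (@eq_int01 _ _ (fun t => (1 - t) ^+ m * dgreen t y)).
  by rewrite (moments0_dgreen _ mn) ?mulr0// I01E.
by move=> t _; rewrite mulrC.
Qed.

(** The representation property: J n w is the element of the Sobolev space whose
    k-th derivative is w. *)
Lemma riesz_pairing w f : L1 w -> moments0 w -> L1 f ->
  \int[leb]_(y in I01 R) (f y * J n w y) = \int[leb]_(x in I01 R) (w x * riesz f x).
Proof.
move=> Lw ow Lf; apply: etrans (esym (kint_fubini bkernel_dgreen Lw Lf)).
by apply: eq_int01 => y y01; rewrite J_dgreen// I01E.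
Qed.

Lemma J_riesz f y : L1 f -> 0 < y < 1 ->
  J n (riesz f) y = \int[leb]_(z in I01 R) (green y z * f z).
Proof.
move=> Lf y01; have yI : I01 R y by rewrite I01E.
have Lp := bdd_L1 (bdd_riesz Lf).
rewrite J_dgreen//; last exact: moments0_riesz.
rewrite [LHS](kint_fubini bkernel_dgreen (L1_dgreen yI) Lf).
apply: eq_int01 => z _; rewrite mulrC; congr (_ * _).
by apply: eq_int01 => t _; rewrite mulrC.
Qed.

Lemma riesz_norm f : L1 f -> \int[leb]_(x in I01 R) (riesz f x ^+ 2) =
  \int[leb]_(y in I01 R) (f y * J n (riesz f) y).
Proof.
move=> Lf; rewrite riesz_pairing//; [exact: bdd_L1 (bdd_riesz Lf)|exact: moments0_riesz].
Qed.

Lemma L1_green f y : L1 f -> 0 < y < 1 -> L1 (fun z => green y z * f z).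
Proof.
move=> Lf y01; have yI : I01 R y by rewrite I01E.
apply: L1_bddM => //.
have := bdd_kint (bkernelC bkernel_dgreen) (L1_dgreen yI).
congr bdd; apply/funext => z; rewrite /kint; apply: eq_int01 => t _.
by rewrite mulrC.
Qed.

(** The squared norm of the representative is the quadratic form of the Green
    function, whose entries are positive: replacing f by a majorant of its
    absolute value can only increase it. *)
Lemma riesz_le f rho : L1 f -> L1 rho ->
  {ae leb, forall x, I01 R x -> `|f x| <= rho x} ->
  \int[leb]_(x in I01 R) (riesz f x ^+ 2) <= \int[leb]_(x in I01 R) (riesz rho x ^+ 2).
Proof.
move=> Lf Lr fr; rewrite (riesz_norm Lf) (riesz_norm Lr).
have J_le y : 0 < y < 1 -> `|J n (riesz f) y| <= J n (riesz rho) y.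
  move=> y01; rewrite (J_riesz Lf y01) (J_riesz Lr y01); have LG := L1_green Lf y01.
  apply: le_trans (@le_normr_Rintegral _ _ _ leb _ _ measurable_I01 LG) _.
  apply: ae_le_int01; [|exact: L1_norm LG|exact: L1_green].
  apply: ae_imp fr => z h zI; have z01 := zI; rewrite I01E in z01.
  have G0 := green_gt0 y01 z01.
  by rewrite normrM gtr0_norm// ler_wpM2l ?h// ltW.
have bJ g : L1 g -> bdd (J n (riesz g)).
  by move=> Lg; apply: bdd_J; apply: bdd_L1; exact: bdd_riesz.
have LJ g : L1 g -> L1 (fun y => g y * J n (riesz g) y).
  by move=> Lg; under eq_fun do rewrite mulrC; apply: L1_bddM => //; exact: bJ.
apply: ae_le_int01; [|exact: LJ|exact: LJ].
apply: ae_imp fr => y h yI; have y01 := yI; rewrite I01E in y01.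
apply: le_trans (ler_norm _) _; rewrite normrM; apply: ler_pM => //; first exact: h.
exact: J_le.
Qed.

(** If the quadratic form vanished then, by positivity of the Green function
    used twice, rho would vanish almost everywhere. *)
Lemma riesz_norm_gt0 rho : L1 rho -> {ae leb, forall x, I01 R x -> 0 <= rho x} ->
  ~ ae_zero rho -> 0 < \int[leb]_(x in I01 R) (riesz rho x ^+ 2).
Proof.
move=> Lr r0 nr; rewrite lt_neqAle eq_sym; apply/andP; split; last first.
  by apply: Rintegral_ge0 => x _; exact: sqr_ge0.
apply/eqP; rewrite (riesz_norm Lr) => E0; apply: (nr).
have LJ : L1 (fun y => rho y * J n (riesz rho) y).
  under eq_fun do rewrite mulrC; apply: L1_bddM => //.
  by apply: bdd_J; apply: bdd_L1; exact: bdd_riesz.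
have Jge0 y : 0 < y < 1 -> {ae leb, forall z, I01 R z -> 0 <= green y z * rho z}.
  move=> y01; apply: ae_imp r0 => z h zI; have z01 := zI; rewrite I01E in z01.
  by rewrite mulr_ge0 ?h// ltW// green_gt0.
have Jpos y : 0 < y < 1 -> 0 <= J n (riesz rho) y.
  move=> y01; rewrite (J_riesz Lr y01); apply: ae_ge0_int01; first exact: Jge0.
  exact: L1_meas (L1_green Lr y01).
have : ae_zero (fun y => rho y * J n (riesz rho) y).
  apply: int01_eq0 => //; apply: ae_imp r0 => y h yI; rewrite mulr_ge0 ?h//.
  by apply: Jpos; rewrite -I01E.
apply: ae_imp => y h yI; have /eqP := h yI; rewrite mulf_eq0 => /orP[/eqP //|/eqP Jy].
have y01 := yI; rewrite I01E in y01.
exfalso.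
have Gz : ae_zero (fun z => green y z * rho z).
  by apply: int01_eq0; [exact: Jge0|exact: L1_green|rewrite -(J_riesz Lr y01)].
apply: nr; apply: ae_imp Gz => z hz zI; have z01 := zI; rewrite I01E in z01.
have /eqP := hz zI; rewrite mulf_eq0 gt_eqF ?green_gt0//= => /eqP.
exact.
Qed.
End GreenKernel.

(** * The extremal problem *)

Section Extremal.
Context {R : realType}.
Local Notation leb := (@lebesgue_measure R).
Implicit Types (a b c x y z t : R) (f g u w rho : R -> R).

(** Cauchy-Schwarz with the second norm replaced by a positive upper bound N,
    which avoids the case of a vanishing norm. *)
Lemma int01_CS f g N : L2 f -> L2 g -> 0 < N ->
  \int[leb]_(x in I01 R) (g x ^+ 2) <= N ->
  (\int[leb]_(x in I01 R) (f x * g x)) ^+ 2 <=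
  (\int[leb]_(x in I01 R) (f x ^+ 2)) * N.
Proof.
move=> Lf Lg N0 gN; have Lfg := L2M_L1 Lf Lg.
have [Lf2 Lg2] := (L1_sqr Lf, L1_sqr Lg).
set C := \int[leb]_(x in I01 R) (f x * g x).
set A := \int[leb]_(x in I01 R) (f x ^+ 2).
(* The coefficient C / N would be the optimal one if N were the norm of g. *)
have : 0 <= \int[leb]_(x in I01 R) ((f x - C / N * g x) ^+ 2).
  by apply: Rintegral_ge0 => x _; exact: sqr_ge0.
rewrite (@eq_int01 _ _ (fun x => (f x ^+ 2 - (2 * (C / N)) * (f x * g x)) +
  (C / N) ^+ 2 * g x ^+ 2)); last by move=> x _; ring.
rewrite int01D; [|by apply: L1B => //; exact: L1Z|exact: L1Z].
rewrite int01B//; last exact: L1Z.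
rewrite !int01Z// -/C -/A => h.
have h2 : 0 <= A - 2 * (C / N) * C + (C / N) ^+ 2 * N.
  by apply: le_trans h _; rewrite lerD2l ler_wpM2l// sqr_ge0.
have : 0 <= (A - 2 * (C / N) * C + (C / N) ^+ 2 * N) * N by rewrite mulr_ge0// ltW.
rewrite (_ : _ * N = A * N - C ^+ 2); first by rewrite subr_ge0.
by field; rewrite gt_eqF.
Qed.

Context (n : nat) (rho : R -> R) (rho_L1 : L1 rho)
  (rho_ge0 : {ae leb, forall x, I01 R x -> 0 <= rho x}) (rho_neq0 : ~ ae_zero rho).

Local Notation N2 := (\int[leb]_(x in I01 R) (riesz n rho x ^+ 2)).

Let N2_gt0 : 0 < N2.
Proof. exact: riesz_norm_gt0. Qed.

Definition sgn t : R := (0 < t)%R%:R - (t < 0)%R%:R.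

Lemma sgnE t : sgn t * t = `|t|.
Proof.
rewrite /sgn; have [t0|t0|->] := ltgtP t 0; last by rewrite mulr0 normr0.
- by rewrite ltr0_norm// sub0r mulN1r.
- by rewrite gtr0_norm// subr0 mul1r.
Qed.

Lemma sgn_le1 t : `|sgn t| <= 1.
Proof.
rewrite /sgn; have [t0|t0|_] := ltgtP t 0.
- by rewrite sub0r normrN normr1.
- by rewrite subr0 normr1.
- by rewrite subrr normr0.
Qed.

(** The absolute value is removed by giving rho the sign of u. The weight f then
    satisfies |f| <= rho, and its representative is dominated in norm by that
    of rho. *)
Lemma weighted_norm_le u uk : sobolev0 n.+1 u -> L2 uk -> weak_deriv n.+1 u uk ->
  (\int[leb]_(x in I01 R) (`|u x| * rho x)) ^+ 2 <=
  (\int[leb]_(x in I01 R) (uk x ^+ 2)) * N2.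
Proof.
move=> su Luk wk; have [/= uE ouk] := sobolev0_repr (ltn0Sn n) su Luk wk.
have L1uk := L2_L1 Luk; have bv := bdd_J n L1uk.
pose f x := sgn (J n uk x) * rho x.
have msg : bdd (fun x => sgn (J n uk x)).
  split; last by exists 1 => x _; exact: sgn_le1.
  apply: (@measurableT_comp _ _ _ _ _ _ sgn); last by case: bv.
  apply: measurable_funB; apply: measurable_step => //; exact: measurable_cst.
have Lf : L1 f by exact: L1_bddM.
have fr : {ae leb, forall x, I01 R x -> `|f x| <= rho x}.
  apply: ae_imp rho_ge0 => x h /h r0.
  by rewrite /f normrM (ger0_norm r0) ler_piMl// sgn_le1.
have -> : \int[leb]_(x in I01 R) (`|u x| * rho x) =
    \int[leb]_(x in I01 R) (uk x * riesz n f x).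
  rewrite -riesz_pairing//; apply: ae_eq_int01.
  - apply: measurable_funM; last exact: L1_meas.
    by apply: measurableT_comp => //; have [[[mu _] _] _] := su.
  - by apply: measurable_funM; [exact: L1_meas|case: bv].
  apply: ae_imp uE => x h /h ->.
  by rewrite /f -sgnE mulrAC.
apply: int01_CS => //; first exact: L2_bdd (bdd_riesz n Lf).
exact: riesz_le.
Qed.

(** For the solution with right-hand side rho, the pairing with rho is the
    squared norm, which is therefore a lower bound for the denominator. *)
Lemma weighted_norm_riesz_ge : N2 <= \int[leb]_(x in I01 R) (`|J n (riesz n rho) x| * rho x).
Proof.
rewrite (riesz_norm n rho_L1).
have bJ : bdd (J n (riesz n rho)) by exact: bdd_J (bdd_L1 (bdd_riesz n rho_L1)).
have bnJ : bdd (fun x => `|J n (riesz n rho) x|).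
  by split; [apply: measurableT_comp => //; case: bJ|case: bJ => _ [C hC]; exists C => x /hC; rewrite normr_id].
apply: ae_le_int01.
- apply: ae_imp rho_ge0 => x h /h r0; rewrite mulrC ler_wpM2r//; exact: ler_norm.
- by under eq_fun do rewrite mulrC; apply: L1_bddM.
- exact: L1_bddM.
Qed.

(** Lower bound by weighted_norm_le; the solution with right-hand side rho
    attains it. *)
Lemma quotients_inf : ereal_inf (quotients n.+1 rho) = ((Num.sqrt N2)^-1)%:E.
Proof.
have s0 : 0 < Num.sqrt N2 by rewrite sqrtr_gt0.
have sq (w : R -> R) : \int[leb]_(x in I01 R) (`|w x| ^+ 2) =
    \int[leb]_(x in I01 R) (w x ^+ 2).
  by apply: eq_int01 => x _; rewrite real_normK ?num_real.
apply/eqP; rewrite eq_le; apply/andP; split; last first.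
  apply: le_ereal_inf_tmp => _ [u [uk [su nu Luk wk ->]]]; rewrite /quotient.
  case: ifPn => [_|den0]; first exact: leey.
  rewrite lee_fin sq; set A := \int[leb]_(x in _) (uk x ^+ 2).
  set D := \int[leb]_(x in _) _ in den0 *.
  have D0 : 0 <= D.
    apply: ae_ge0_int01; first by apply: ae_imp rho_ge0 => x h /h r0; rewrite mulr_ge0.
    apply: measurable_funM; last exact: L1_meas.
    by apply: measurableT_comp => //; have [[[mu _] _] _] := su.
  have Dpos : 0 < D by rewrite lt_neqAle eq_sym den0.
  have A0 : 0 <= A by apply: Rintegral_ge0 => x _; exact: sqr_ge0.
  rewrite ler_pdivlMr// ler_pdivrMl//.
  rewrite -(ler_pXn2r (ltn0Sn 1)) ?nnegrE ?mulr_ge0 ?sqrtr_ge0//.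
  rewrite exprMn !sqr_sqrtr ?(ltW N2_gt0)// mulrC.
  exact: weighted_norm_le.
have bp := bdd_riesz n rho_L1.
have [su wk] := sobolev0_J (ltn0Sn n) (L2_bdd bp) (moments0_riesz rho_L1).
rewrite succnK in su wk.
have den := weighted_norm_riesz_ge; have den0 := lt_le_trans N2_gt0 den.
apply: (@le_trans _ _ (quotient rho (J n (riesz n rho)) (riesz n rho))).
  apply: ereal_inf_lbound; exists (J n (riesz n rho)), (riesz n rho); split => //.
    move=> z; have E : \int[leb]_(x in I01 R) (`|J n (riesz n rho) x| * rho x) = 0.
      rewrite (@ae_eq_int01 _ _ (fun=> 0)) ?int01_cst//.
      - apply: measurable_funM; last exact: L1_meas.
        by apply: measurableT_comp => //; case: (bdd_J n (bdd_L1 bp)).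
      - by apply: ae_imp z => x h /h ->; rewrite normr0 mul0r.
    by rewrite E ltxx in den0.
  exact: L2_bdd.
rewrite /quotient gt_eqF// lee_fin sq ler_pdivrMr//.
rewrite mulrC ler_pdivlMr// -expr2 sqr_sqrtr// ltW//.
Qed.

Lemma mu_inv : ((mu n.+1 rho)^-1 = N2%:E)%E.
Proof.
have s0 : Num.sqrt N2 != 0 by rewrite gt_eqF ?sqrtr_gt0.
rewrite /mu /Lambda quotients_inf inveK -EFin_expe inver.
rewrite expf_eq0/= invr_eq0 (negbTE s0) exprVn invrK.
by rewrite sqr_sqrtr ?ltW.
Qed.

(** Integrating the kernel against rho reproduces the closed formula: the powers
    of 1 - t become the vector b. *)
Lemma rieszE x : 0 < x < 1 -> riesz n rho x =
  \sum_(j < n.+1) x ^+ (n.+1 - 1 - j) / ((n.+1 - 1 - j)`!)%:R *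
     (\sum_(m < n.+1) invmx (Amx R n.+1) j m * bvec n.+1 rho m) +
  (-1) ^+ n.+1 * \int[leb]_(t in `]0, x[)
     ((x - t) ^+ (n.+1 - 1) / ((n.+1 - 1)`!)%:R * rho t).
Proof.
move=> x01; rewrite subSS subn0 J_itv//.
have xI : I01 R x by rewrite I01E.
have LJ : L1 (fun y => Jker n x y * rho y) by apply: L1_kernel => //; exact: bkernel_Jker.
have Lom m : L1 (fun y => (1 - y) ^+ m * rho y) by apply: L1_bddM => //; exact: bdd_omX.
pose cj (j : 'I_n.+1) := x ^+ (n - j) / ((n - j)`!)%:R.
pose Fm j (m : 'I_n.+1) y := (cj j * invmx (Amx R n.+1) j m * (-1) ^+ n) *
   ((1 - y) ^+ (n.+1 + m) * rho y).
have LF j m : L1 (Fm j m) by exact: L1Z.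
have LS j : L1 (fun y => \sum_(m < n.+1) Fm j m y).
  by have [] := int01_sum (index_enum _) (LF j).
have [LSS ESS] := int01_sum (index_enum _) LS.
rewrite /riesz /kint (@eq_int01 _ _ (fun y => \sum_(j < n.+1) \sum_(m < n.+1) Fm j m y +
   (-1) ^+ n.+1 * (Jker n x y * rho y))); last first.
  move=> y _; rewrite /dgreen dgreen_polyE mulrDl mulr_suml; congr (_ + _); last by rewrite -mulrA.
  apply: eq_bigr => j _; rewrite mulr_sumr mulr_suml; apply: eq_bigr => m _.
  by rewrite /Fm /cj; ring.
rewrite (int01D LSS (L1Z _ LJ)) ESS (int01Z _ LJ); congr (_ + _).
apply: eq_bigr => j _; have [_ ->] := int01_sum (index_enum _) (LF j).
rewrite mulr_sumr; apply: eq_bigr => m _.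
by rewrite /Fm int01Z// /bvec -/(cj j) !exprS; ring.
Qed.
End Extremal.

Theorem mainTheorem2 (R : realType) (k : nat) (hk : (1 <= k)%N) (rho : R -> R)
    (rho_L1 : L1 rho)
    (rho_ge0 : {ae @lebesgue_measure R, forall x, I01 R x -> 0 <= rho x})
    (rho_neq0 : ~ ae_zero rho) :
  Amx R k \in unitmx /\
  ((mu k rho)^-1 =
   \int[@lebesgue_measure R]_(x in I01 R)
     ((\sum_(j < k) x ^+ (k - 1 - j) / ((k - 1 - j)`!)%:R *
         (\sum_(m < k) invmx (Amx R k) j m * bvec k rho m) +
       (-1) ^+ k *
         \int[@lebesgue_measure R]_(t in `]0, x[)
           ((x - t) ^+ (k - 1) / ((k - 1)`!)%:R * rho t)) ^+ 2)%R%:E)%E.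
Proof.
case: k hk => // n _; split; first exact: Amx_unit.
rewrite mu_inv// -int01_EFin; last exact: L1_sqr (L2_bdd (bdd_riesz n rho_L1)).
by apply: eq_integral => x; rewrite inE I01E => x01; rewrite rieszE.
Qed.
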